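(* Let $J$ be a non-infinitesimal interval of ${}^\bullet\mathbb{R}$ and let $f:J\to{}^\bullet\mathbb{R}$ be a smooth function. Let $\{I_1,\dots,I_n\}$ and $\{J_1,\dots,J_m\}$ be two finite families of pairwise disjoint intervals in $\mathscr{I}$, all contained in $J$, such that $\bigcup_{i=1}^n I_i=\bigcup_{j=1}^m J_j=:U$. Then $$\sum_{i=1}^n\int_{I_i}f=\sum_{j=1}^m\int_{J_j}f,$$ and this common value is denoted $\int_U f$.
   Context: Fermat reals: let $\mathbb{R}_o[t]$ be the set of maps $x:\mathbb{R}_{\ge0}\to\mathbb{R}$, $t\mapsto x_t$, of the form $x_t=r+\sum_{i=1}^k\alpha_i t^{a_i}+o(t)$ as $t\to0^+$, with $k\in\mathbb{N}$, $r,\alpha_i\in\mathbb{R}$, $a_i\in\mathbb{R}_{\ge0}$. Write $x\sim y$ iff $x_t=y_t+o(t)$ as $t\to0^+$. The ring of Fermat reals is ${}^\bullet\mathbb{R}:=\mathbb{R}_o[t]/\sim$ with pointwise operations; $\mathbb{R}\subseteq{}^\bullet\mathbb{R}$ via constants. The standard part of $x=[x_t]$ is ${}^\circ x:=x_0$. ${}^\bullet\mathbb{R}$ is totally ordered by: $x\le y$ iff for representatives there is $z\in\mathbb{R}_o[t]$ with $z\sim0$ and $x_t\le y_t+z_t$ for all small $t\ge0$. $\overline{{}^\bullet\mathbb{R}}:={}^\bullet\mathbb{R}\cup\{\pm\infty\}$, ${}^\circ(\pm\infty):=\pm\infty$. An interval is a set $[a,b],(a,b),[a,b),(a,b]$ of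 points of ${}^\bullet\mathbb{R}$ with $a\le b$ in $\overline{{}^\bullet\mathbb{R}}$ (it determines its endpoints $a=\inf$, $b=\sup$); non-infinitesimal if ${}^\circ a<{}^\circ b$; $\mathscr{I}$ denotes the set of all intervals. The Fermat topology on ${}^\bullet\mathbb{R}^n$ has open sets ${}^\bullet V:=\{x:{}^\circ x\in V\}$, $V\subseteq\mathbb{R}^n$ open. For $\alpha\in C^\infty(W,\mathbb{R}^m)$, $W\subseteq\mathbb{R}^d$ open, ${}^\bullet\alpha([x_t]):=[\alpha(x_t)]$. A map $f:S\to{}^\bullet\mathbb{R}^m$, $S\subseteq{}^\bullet\mathbb{R}^n$, is smooth if for every $x\in S$ there exist open $V\subseteq\mathbb{R}^n$ with $x\in{}^\bullet V$, open $P\subseteq\mathbb{R}^{\mathsf p}$, $p\in{}^\bullet P$, $\alpha\in C^\infty(P\times V,\mathbb{R}^m)$ with $f(y)={}^\bullet\alpha(p,y)$ for $y\in{}^\bullet V\cap S$. For $g$ smooth on a non-infinitesimal interval $J$ and $x\in J$, $g'(x):={}^\bullet(\partial_2\alpha)(p,x)$ for any local representation of $g$ around $x$ (independent of it). Integral: for a non-infinitesimal interval $J$, smooth $f:J\to{}^\bullet\mathbb{R}$ and $u\in J$, $\int_u^{(-)}f$ is the unique smooth $I:J\to{}^\bullet\mathbb{R}$ with $I(u)=0$ and $I'(x)=f(x)$ for all $x\in J$, and $\int_u^v f:=I(v)$ for $v\in J$. For an interval $I\in\mathscr{I}$ contained in $J$, $\int_I f:=\int_{\inf(I)}^{\sup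(I)}f$.
   Formalization: The formal theorem also assumes that inf and sup of every I_i and J_j are points of J; otherwise (e.g. I_1 = J = (0,1)) the integral over I_i, defined as the integral from inf(I_i) to sup(I_i), is undefined, since its limits must lie in J. *)

(* Defs.v *)
From HB Require Import structures.
From mathcomp Require Import all_boot all_order all_algebra.
From mathcomp Require Import all_classical all_reals all_analysis.
Set Implicit Arguments. Unset Strict Implicit. Unset Printing Implicit Defensive.
Import Order.TTheory GRing.Theory Num.Theory.
Import numFieldNormedType.Exports.
Local Open Scope classical_set_scope.
Local Open Scope ring_scope.

Section FermatReals.
Variable R : realType.

Definition tpow (t a : R) : R :=
  if t == 0 then (if a == 0 then 1 else 0) else t `^ a.

(* h(t) = o(t) as t -> 0^+ (on t >= 0, so in particular h 0 = 0). *)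
Definition little_o_t (h : R -> R) : Prop :=
  forall e : R, 0 < e -> exists2 d : R, 0 < d &
    forall t : R, 0 <= t -> t < d -> `|h t| <= e * t.

(* x_t = r + sum_i alpha_i t^(a_i) + o(t); a term is a pair (alpha_i, a_i).
   Maps R_{>=0} -> R are represented by maps R -> R (values at t < 0 are
   irrelevant for everything below). *)
Definition Ro (x : R -> R) : Prop :=
  exists (r : R) (s : seq (R * R)), (forall p, p \in s -> 0 <= p.2) /\
    little_o_t (fun t => x t - r - \sum_(p <- s) p.1 * tpow t p.2).

Definition frel (x y : R -> R) : Prop := little_o_t (fun t => x t - y t).

Definition FR : Type :=
  {P : (R -> R) -> Prop | exists x, Ro x /\ P = (fun y => Ro y /\ frel y x)}.

Definition is_rep (X : FR) (x : R -> R) : Prop := proj1_sig X x.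

Definition rep (X : FR) : R -> R := proj1_sig (cid (proj2_sig X)).

Lemma Ro0 : Ro (fun _ => 0).
Proof.
exists 0, [::]; split => [p|]; first by rewrite in_nil.
move=> e e0; exists 1 => // t t0 _.
by rewrite big_nil !subr0 normr0 mulr_ge0 // ltW.
Qed.

Definition fr0 : FR :=
  exist _ (fun y => Ro y /\ frel y (fun _ => 0))
    (ex_intro _ (fun _ => 0) (conj Ro0 erefl)).

(* the class [x] of a map x (meaningful when x \in R_o[t]; default 0) *)
Definition cls (x : R -> R) : FR :=
  match pselect (Ro x) with
  | left h => exist _ (fun y => Ro y /\ frel y x) (ex_intro _ x (conj h erefl))
  | right _ => fr0
  end.

Definition addFR (X Y : FR) : FR := cls (fun t => rep X t + rep Y t).

Definition stdp (X : FR) : R := rep X 0.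

Definition leFR (X Y : FR) : Prop :=
  exists z : R -> R, [/\ Ro z, frel z (fun _ => 0) &
    exists2 d : R, 0 < d & forall t, 0 <= t -> t < d -> rep X t <= rep Y t + z t].
Definition ltFR (X Y : FR) : Prop := leFR X Y /\ X <> Y.

Inductive extFR := NInf | Fin of FR | PInf.

Definition leE (a b : extFR) : Prop :=
  match a, b with
  | NInf, _ => True
  | _, PInf => True
  | Fin x, Fin y => leFR x y
  | _, _ => False
  end.
Definition ltE (a b : extFR) : Prop := leE a b /\ a <> b.

Definition stdE (a : extFR) : \bar R :=
  match a with NInf => -oo%E | Fin x => (stdp x)%:E | PInf => +oo%E end.

Record FRinterval := mkInterval {
  ilo : extFR; ihi : extFR; ilo_closed : bool; ihi_closed : bool;
  i_le : leE ilo ihi }.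

Definition imem (I : FRinterval) : set FR :=
  [set x | (if ilo_closed I then leE (ilo I) (Fin x) else ltE (ilo I) (Fin x)) /\
           (if ihi_closed I then leE (Fin x) (ihi I) else ltE (Fin x) (ihi I))].

Definition noninf (I : FRinterval) : Prop := (stdE (ilo I) < stdE (ihi I))%E.

Definition iter_dir {V : normedModType R} (vs : seq V) (g : V -> R^o) : V -> R^o :=
  foldr (fun v h => fun x => 'D_v h x) g vs.

Definition smooth_on {V : normedModType R} (U : set V) (g : V -> R^o) : Prop :=
  forall vs : seq V, forall x, U x ->
    (forall v, derivable (iter_dir vs g) x v) /\ {for x, continuous (iter_dir vs g)}.

Definition stdv (pp : nat) (p : 'I_pp -> FR) : 'rV[R]_pp := \row_i stdp (p i).
Definition repv (pp : nat) (p : 'I_pp -> FR) (t : R) : 'rV[R]_pp := \row_i rep (p i) t.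

(* (V, pp, P, p, alpha) is a local representation of f : S -> •R around x:
   x \in •V, p \in •P, alpha \in C^oo(P x V, R), f y = •alpha(p, y) on •V \cap S *)
Definition local_rep (S : set FR) (f : FR -> FR) (x : FR)
    (V : set R) (pp : nat) (P : set 'rV[R]_pp) (p : 'I_pp -> FR)
    (alpha : ('rV[R]_pp * R^o)%type -> R^o) : Prop :=
  [/\ open V /\ V (stdp x), open P, P (stdv p),
      smooth_on (P `*` V) alpha &
      forall y, S y -> V (stdp y) ->
        is_rep (f y) (fun t => alpha (repv p t, rep y t))].

Definition smoothFR (S : set FR) (f : FR -> FR) : Prop :=
  forall x, S x -> exists V pp P p alpha, @local_rep S f x V pp P p alpha.

Definition d2 (pp : nat) (alpha : ('rV[R]_pp * R^o)%type -> R^o)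
  : ('rV[R]_pp * R^o)%type -> R^o :=
  fun z => 'D_((0 : 'rV[R]_pp), (1 : R^o)) alpha z.

(* g'(x) = d : d = •(d2 alpha)(p, x) for a local representation of g around x
   (independent of the representation, by the paper) *)
Definition FRderiv (S : set FR) (g : FR -> FR) (x d : FR) : Prop :=
  exists V pp P p alpha, @local_rep S g x V pp P p alpha /\
    is_rep d (fun t => d2 alpha (repv p t, rep x t)).

Definition is_primitive (J : set FR) (f : FR -> FR) (u : FR) (I : FR -> FR) : Prop :=
  [/\ smoothFR J I, I u = fr0 & forall x, J x -> FRderiv J I x (f x)].

(* int_u^v f (the primitive exists and is unique by the paper; we pick it) *)
Definition FRint (J : set FR) (f : FR -> FR) (u v : FR) : FR :=
  match pselect (exists I, is_primitive J f u I) with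
  | left h => proj1_sig (cid h) v
  | right _ => fr0
  end.

Definition FRintI (J : set FR) (f : FR -> FR) (I : FRinterval) : FR :=
  match ilo I, ihi I with
  | Fin a, Fin b => FRint J f a b
  | _, _ => fr0
  end.

(* the endpoints of I are points of J (so that int_I f is defined) *)
Definition endpoints_in (J : set FR) (I : FRinterval) : Prop :=
  exists a b, [/\ ilo I = Fin a, ihi I = Fin b, J a & J b].

End FermatReals.

(* Main.v *)
(* Two primitives I1, I2 of f differ by a constant. Near a standard point x0 put
   the parameter p_t of a local representation alpha of I1 or I2 in the form
   p_0 + nilpotent and expand d2 alpha(p_t, h) by Taylor's formula in p only:
   up to a remainder o(t), uniform in h near x0, it is a finite sum
   sum_k m_k(t) e_k(h). If E_k' = e_k, the mean value theorem in h gives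
   I(y) - I(y') = sum_k m_k(t) (E_k(y_t) - E_k(y'_t)) + o(t). For fixed m_k, the
   vectors c with sum_k m_k c_k = o(t) form a subspace of a finite-dimensional
   space, which is closed; so relations holding pointwise in h may be
   differentiated and integrated. Since (I1 - I2)' = 0, all derivatives of
   order >= 1 of the vector (E_k) for I1 - I2 lie in that subspace, whence
   I1 - I2 is locally, hence globally, constant.

   Consequently either no primitive exists and all integrals are the default
   value 0, or int_a^b f = F(b) - F(a) for a single F. Both sums are then
   rearranged over the consecutive gaps of the sorted list of all endpoints; a
   gap contributes iff its midpoint lies in U. *)
Require Import Defs.
From HB Require Import structures.
From mathcomp Require Import all_boot all_order all_algebra.
From mathcomp Require Import all_classical all_reals all_analysis.
From mathcomp Require Import ring lra.
Set Implicit Arguments. Unset Strict Implicit. Unset Printing Implicit Defensive.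
Import Order.TTheory GRing.Theory Num.Theory.
Import numFieldNormedType.Exports.
Local Open Scope classical_set_scope.
Local Open Scope ring_scope.

(** * Maps negligible, bounded or nilpotent at 0+ *)

Section Little_o.
Context {R : realType}.
Implicit Types (f g h m : R -> R) (T : finType).

(** The obstacle: a derivative at a point may be witnessed by any local representation, with its own
    parameter, so the expansions of two primitives, or of one primitive around two points, have
    unrelated coefficients. The maps m_k(t) have no common scale and cannot be compared term by
    term; what survives is the linear relations among them modulo o(t). The variable h stays free in
    the expansion because y_t is merely near x0: y_t - x0 need not be nilpotent, whereas p_t - p_0
    always is. Over an end of J the constant with that standard part may lie outside J. Relations
    are therefore derived over the interior of the set of standard parts and extended to the ends by
    continuity. Each integral from a chooses its own primitive vanishing at a. A single F serves all
    of them only if existence does not depend on the base point; this is obtained by subtracting a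
    possibly nonstandard constant, entered as one more parameter. Midpoints are tested because they
    avoid the endpoints, where open and closed intervals differ. *)

Definition bounded0 m := exists C : R, exists2 d : R, 0 < d &
  forall t, 0 <= t -> t < d -> `|m t| <= C.

Lemma bounded0_pos m : bounded0 m -> exists2 C : R, 0 < C & exists2 d : R, 0 < d &
  forall t, 0 <= t -> t < d -> `|m t| <= C.
Proof.
move=> [C [d d0 H]]; exists (`|C| + 1); first by rewrite ltr_wpDl.
exists d => // t t0 td; apply: (le_trans (H t t0 td)).
by rewrite ler_wpDr// ler_norm.
Qed.

Lemma little_o_dom f g : (exists C : R, exists2 d : R, 0 < d &
    forall t, 0 <= t -> t < d -> `|f t| <= C * `|g t|) ->
  little_o_t g -> little_o_t f.
Proof.
move=> [C [d d0 H]] og e e0.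
have C0 : 0 < `|C| + 1 by rewrite ltr_wpDl.
have [d' d'0 H'] := og (e / (`|C| + 1)) (divr_gt0 e0 C0).
exists (Num.min d d'); first by rewrite lt_min d0 d'0.
move=> t t0; rewrite lt_min => /andP[td td'].
apply: (le_trans (H t t0 td)).
apply: (@le_trans _ _ ((`|C| + 1) * `|g t|)).
  by apply: ler_wpM2r => //; rewrite ler_wpDr// ler_norm.
have := H' t t0 td'; rewrite -(ler_pM2l C0) => /le_trans; apply.
by rewrite mulrA [e / _]mulrC mulVKf// gt_eqF.
Qed.

Lemma little_o_eq f g : f =1 g -> little_o_t g -> little_o_t f.
Proof. by move=> /funext ->. Qed.

Lemma little_o0 : little_o_t (fun _ : R => 0 : R).
Proof.
move=> e e0; exists 1 => // t t0 _; rewrite normr0.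
by apply: mulr_ge0 => //; exact: ltW.
Qed.

Lemma little_oD f g : little_o_t f -> little_o_t g -> little_o_t (fun t => f t + g t).
Proof.
move=> of_ og e e0; have e20 : 0 < e / 2 by rewrite divr_gt0.
have [d d0 H] := of_ _ e20; have [d' d'0 H'] := og _ e20.
exists (Num.min d d'); first by rewrite lt_min d0 d'0.
move=> t t0; rewrite lt_min => /andP[td td'].
apply: (le_trans (ler_normD _ _)).
by have := lerD (H t t0 td) (H' t t0 td'); rewrite -mulrDl -splitr.
Qed.

Lemma little_oM m f : bounded0 m -> little_o_t f -> little_o_t (fun t => m t * f t).
Proof.
move=> [C [d d0 H]]; apply: little_o_dom; exists C, d => // t t0 td.
by rewrite normrM ler_wpM2r// H.
Qed.

Lemma bounded0_cst (c : R) : bounded0 (fun _ => c).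
Proof. by exists `|c|, 1. Qed.

Lemma bounded0M f g : bounded0 f -> bounded0 g -> bounded0 (fun t => f t * g t).
Proof.
move=> [C [d d0 H]] [C' [d' d'0 H']]; exists (C * C'), (Num.min d d').
  by rewrite lt_min d0 d'0.
move=> t t0; rewrite lt_min => /andP[td td'].
by rewrite normrM ler_pM ?H ?H'.
Qed.

Lemma bounded0X f n : bounded0 f -> bounded0 (fun t => f t ^+ n).
Proof.
move=> bf; elim: n => [|n IHn]; first exact: bounded0_cst.
by under eq_fun do rewrite exprS; exact: bounded0M.
Qed.

Lemma little_oZ (c : R) f : little_o_t f -> little_o_t (fun t => c * f t).
Proof. exact/little_oM/bounded0_cst. Qed.

Lemma little_oN f : little_o_t f -> little_o_t (fun t => - f t).
Proof.
by move=> /(little_oZ (-1)); apply: little_o_eq => t; rewrite mulN1r.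
Qed.

Lemma little_oB f g : little_o_t f -> little_o_t g -> little_o_t (fun t => f t - g t).
Proof. by move=> ? ?; apply: little_oD => //; exact: little_oN. Qed.

Lemma little_o_sum (I : Type) (s : seq I) (P : pred I) (F : I -> R -> R) :
  (forall i, P i -> little_o_t (F i)) -> little_o_t (fun t => \sum_(i <- s | P i) F i t).
Proof.
move=> oF; elim: s => [|i s IHs].
  by apply: little_o_eq little_o0 => t; rewrite big_nil.
have [Pi|Pi] := boolP (P i).
  by apply: little_o_eq (little_oD (oF i Pi) IHs) => t; rewrite big_cons Pi.
by apply: little_o_eq IHs => t; rewrite big_cons (negbTE Pi).
Qed.

Lemma little_o_at0 f : little_o_t f -> f 0 = 0.
Proof.
move=> /(_ 1 ltr01)[d d0 /(_ 0 (lexx _) d0)].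
by rewrite mulr0 normr_le0 => /eqP.
Qed.

Lemma little_o_near f g : (exists2 d : R, 0 < d & forall t, 0 <= t -> t < d -> f t = g t) ->
  little_o_t g -> little_o_t f.
Proof.
move=> [d d0 H]; apply: little_o_dom; exists 1, d => // t t0 td.
by rewrite H// mul1r.
Qed.

Definition vanishing f := forall e : R, 0 < e -> exists2 d : R, 0 < d &
  forall t, 0 <= t -> t < d -> `|f t| <= e.

(** Representatives of nilpotent elements of the ring: a Taylor expansion in such an increment
    stops, modulo o(t), after [N] terms. *)
Definition nilpotent0 f := exists N, little_o_t (fun t => f t ^+ N).

Lemma nilpotent0_vanishing f : nilpotent0 f -> vanishing f.
Proof.
move=> [[|N] oN] e e0; first by move: (little_o_at0 oN) => /eqP; rewrite expr0 oner_eq0.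
have [d d0 H] := oN 1 ltr01.
(* For such t, the power of order N+1 of |f t| is at most t, hence at most that of e; roots are then
   compared. *)
exists (Num.min d (e ^+ N.+1)); first by rewrite lt_min d0 exprn_gt0.
move=> t t0; rewrite lt_min => /andP[td te].
have := H t t0 td; rewrite mul1r normrX => /le_trans/(_ (ltW te)).
by rewrite ler_pXn2r ?nnegrE// ltW.
Qed.

Lemma vanishing_bounded0 f : vanishing f -> bounded0 f.
Proof. by move=> /(_ 1 ltr01)[d d0 H]; exists 1, d. Qed.

Lemma little_o_nilpotent0 f : little_o_t f -> nilpotent0 f.
Proof. by exists 1. Qed.

End Little_o.

(** * Taylor's formula with a bound on the remainder *)

Section Taylor.
Context {R : realType}.

Lemma is_derive_continuous (f : R -> R) (x df : R) : is_derive x 1 f df ->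
  {for x, continuous f}.
Proof.
by move=> [fd _]; apply: differentiable_continuous; rewrite -derivable1_diffP.
Qed.

Lemma mean_value_bound (f df : R -> R) (a b C : R) :
  (forall x, x \in `[Num.min a b, Num.max a b] -> is_derive x 1 f (df x)) ->
  (forall x, x \in `[Num.min a b, Num.max a b] -> `|df x| <= C) ->
  `|f b - f a| <= C * `|b - a|.
Proof.
wlog ab : a b / a <= b.
  move=> H H1 H2; have [/H|/ltW ba] := leP a b; first exact.
  rewrite (distrC (f b)) (distrC b); move: H1 H2; rewrite minC maxC => H1 H2.
  exact: (H b a ba H1 H2).
rewrite (min_idPl ab) (max_idPr ab) => H1 H2.
have cf : {within `[a, b], continuous f}.
  by apply: derivable_within_continuous => x xab; have [] := H1 x xab.
have df_oo x : x \in `]a, b[ -> is_derive x 1 f (df x).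
  by move=> xab; apply: H1; exact: (subset_itv_oo_cc xab).
have [c cab ->] := MVT_segment ab df_oo cf.
by rewrite normrM ler_wpM2r// H2.
Qed.

(** The derivatives are supplied as a sequence [F], so that antiderivatives and iterated directional
    derivatives can fill it alike. There are [N] terms, hence degree [N - 1]. *)
Definition taylor (F : nat -> R -> R) (N : nat) (a x : R) : R :=
  \sum_(k < N) F k a * (x - a) ^+ k / k`!%:R.

Lemma is_derive_taylor F N a x :
  is_derive x (1:R) (taylor F N.+1 a) (taylor (fun k => F k.+1) N a x).
Proof.
rewrite /taylor.
have -> : (fun x0 => \sum_(k < N.+1) F k a * (x0 - a) ^+ k / k`!%:R) =
   \sum_(k < N.+1) (fun x0 : R => (F k a / k`!%:R) * (x0 - a) ^+ k).
  by apply/funext => y; rewrite fct_sumE; apply: eq_bigr => k _; rewrite mulrAC.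
have D (k : 'I_N.+1) : is_derive x (1:R) (fun x0 : R => (F k a / k`!%:R) * (x0 - a) ^+ k)
    ((F k a / k`!%:R) * (k%:R * (x - a) ^+ k.-1)).
  have d1 : is_derive x (1:R) (fun y : R => y - a) (1 - 0) by exact: is_deriveB.
  have -> : (fun x0 : R => F k a / k`!%:R * (x0 - a) ^+ k) =
      (F k a / k`!%:R) *: ((fun y : R => y - a) ^+ k).
    by apply/funext => y; rewrite !fctE.
  have := is_deriveZ (F k a / k`!%:R) (is_deriveX k d1).
  by rewrite subr0 {1 2}/GRing.scale /= mulr1.
have := is_derive_sum D; congr (is_derive _ _ _ _).
rewrite big_ord_recl /= mul0r mulr0 add0r.
apply: eq_bigr => k _; rewrite /bump /= add1n factS natrM.
have k0 : (k.+1%:R : R) != 0 by rewrite pnatr_eq0.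
have kf0 : (k`!%:R : R) != 0 by rewrite pnatr_eq0 -lt0n fact_gt0.
move: k.+1%:R k`!%:R k0 kf0 => u v u0 v0.
by field; rewrite u0 v0.
Qed.

(** The derivative of the remainder is the remainder of the shifted sequence, so the mean value
    bound gives an induction on [N]. Bounding |x - a| by |b - a| at each stage loses the factor
    1/N!, which is harmless here. *)
Lemma taylor_bound (F : nat -> R -> R) (N : nat) (a b C : R) :
  (forall k x, (k < N)%N -> x \in `[Num.min a b, Num.max a b] ->
     is_derive x 1 (F k) (F k.+1 x)) ->
  (forall x, x \in `[Num.min a b, Num.max a b] -> `|F N x| <= C) ->
  `|F 0%N b - taylor F N a b| <= C * `|b - a| ^+ N.
Proof.
elim: N F b => [|N IHN] F b H1 H2.
  by rewrite /taylor big_ord0 subr0 expr0 mulr1 H2// in_itv /= ge_min lexx orbT le_max lexx orbT.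
(* The remainder vanishes at [a], so it is an increment. *)
have -> : F 0%N b - taylor F N.+1 a b =
    (F 0%N b - taylor F N.+1 a b) - (F 0%N a - taylor F N.+1 a a).
  rewrite [X in _ - (_ - X)]/taylor big_ord_recl big1 ?addr0.
    by rewrite expr0 fact0 mulr1 divr1 subrr subr0.
  by move=> i _; rewrite subrr expr0n /= mulr0 mul0r.
rewrite exprSr mulrA.
apply: (@mean_value_bound (fun x => F 0%N x - taylor F N.+1 a x)
  (fun x => F 1%N x - taylor (fun k => F k.+1) N a x)) => x xab.
  apply: is_deriveB; first exact: H1.
  exact: is_derive_taylor.
have sub y : y \in `[Num.min a x, Num.max a x] -> y \in `[Num.min a b, Num.max a b].
  move: xab; rewrite !in_itv /= => /andP[x1 x2] /andP[y1 y2]; apply/andP; split.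
    by apply: le_trans y1; rewrite le_min x1 ge_min lexx.
  by apply: (le_trans y2); rewrite ge_max x2 le_max lexx.
have C0 : 0 <= C by apply: le_trans (H2 a _) => //; rewrite in_itv /= ge_min lexx le_max lexx.
have IH : `|F 1%N x - taylor (fun k => F k.+1) N a x| <= C * `|x - a| ^+ N.
  have H1' k y : (k < N)%N -> y \in `[Num.min a x, Num.max a x] ->
      is_derive y 1 (F k.+1) (F k.+2 y).
    by move=> kN /sub yab; exact: (H1 k.+1 y kN yab).
  have H2' y : y \in `[Num.min a x, Num.max a x] -> `|F N.+1 y| <= C.
    by move=> /sub yab; exact: (H2 y yab).
  exact: (IHN (fun k => F k.+1) x H1' H2').
apply: le_trans IH _.
rewrite ler_wpM2l// lerXn2r ?nnegrE//.
move: xab; rewrite in_itv /=.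
case: (leP a b) => ab /andP[x1 x2].
  by rewrite !ger0_norm ?subr_ge0// lerD2r.
by rewrite !ler0_norm ?subr_le0 ?lerN2 ?lerD2r// ltW.
Qed.

End Taylor.

(** * Limiting processes and expansions modulo o(t) *)

Section Closure.
Context {R : realType}.

(* The coefficient vectors [c] with [\sum_i m i t * c i = o(t)] form a subspace
   of a finite-dimensional space, hence are stable under limiting processes
   [Lam] such as evaluation by continuity, differentiation and integration. *)
Lemma little_o_closure (X : Type) (P : X -> Prop) (Lam : (X -> R) -> R -> Prop)
    (LamD : forall c d v w a, Lam c v -> Lam d w ->
       Lam (fun x => c x + a * d x) (v + a * w))
    (Lam0 : forall c v, Lam c v -> (forall x, P x -> c x = 0) -> v = 0)
    (T : Type) (l : seq T) (m : T -> R -> R) (c : T -> X -> R) (v : T -> R) :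
  (forall i, Lam (c i) (v i)) ->
  (forall x, P x -> little_o_t (fun t => \sum_(i <- l) m i t * c i x)) ->
  little_o_t (fun t => \sum_(i <- l) m i t * v i).
Proof.
elim: l c v => [|i l IHl] c v cv Hc.
  by apply: little_o_eq little_o0 => t; rewrite big_nil.
(* One map is eliminated at a time. Either [m i] is a combination of the others modulo o(t) and is
   substituted, or every relation on [P] has zero coefficient at [i] (otherwise divide by it), and
   this passes to [v i] through [Lam0]. *)
have [[la Hla]|nla] := pselect (exists la : T -> R,
    little_o_t (fun t => m i t - \sum_(j <- l) m j t * la j)).
- have o1 : little_o_t (fun t => \sum_(j <- l) m j t * (v j + la j * v i)).
    apply: (IHl (fun j x => c j x + la j * c i x)) => [j|x Px]; first exact: LamD.
    have := little_oB (Hc x Px) (little_oZ (c i x) Hla).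
    apply: little_o_eq => t; rewrite big_cons mulrBr mulrC opprB addrC addrA.
    rewrite addrNK mulr_sumr -big_split /=; apply: eq_bigr => j _; ring.
  have := little_oD o1 (little_oZ (v i) Hla).
  apply: little_o_eq => t; rewrite big_cons.
  rewrite [in RHS](eq_bigr (fun j => m j t * v j + v i * (m j t * la j))); last by move=> j _; ring.
  by rewrite big_split /= -mulr_sumr; ring.
- have ci0 x : P x -> c i x = 0.
    move=> Px; apply/eqP/negPn/negP => cix0; apply: nla.
    exists (fun j => - (c j x / c i x)).
    have := little_oZ (c i x)^-1 (Hc x Px).
    apply: little_o_eq => t; rewrite big_cons mulrDr mulrCA mulVf// mulr1.
    by rewrite -sumrN mulr_sumr; congr (_ + _); apply: eq_bigr => j _; field.
  have vi0 : v i = 0 by apply: Lam0 ci0.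
  have := IHl c v cv; set G := (G in (_ -> G) -> _) => HG.
  have {HG}: G.
    apply: HG => x Px; have := Hc x Px.
    by apply: little_o_eq => t; rewrite big_cons ci0// mulr0 add0r.
  by apply: little_o_eq => t; rewrite big_cons vi0 mulr0 add0r.
Qed.

Lemma little_o_closure_derive (T : finType) (m c : T -> R -> R) (v : T -> R)
    (r rho : R) : 0 < rho ->
  (forall i, is_derive r 1 (c i) (v i)) ->
  (forall h, `|h - r| < rho -> little_o_t (fun t => \sum_i m i t * c i h)) ->
  little_o_t (fun t => \sum_i m i t * v i).
Proof.
move=> rho0.
apply: (little_o_closure (P := fun h => `|h - r| < rho)
  (Lam := fun c v => is_derive r 1 c v)) => [{}c d {}v w a cv dw|{}c {}v cv c0].
  exact: (is_deriveD cv (is_deriveZ a dw)).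
have <- : 'D_1 c r = v by exact: derive_val.
rewrite (@near_eq_derive _ _ _ c (cst 0)) ?derive_cst//.
near=> h; apply: c0.
rewrite distrC; near: h.
by exists rho.
Unshelve. all: by end_near. Qed.

Lemma little_o_closure_continuous (T : finType) (m c : T -> R -> R) (S : set R)
    (r : R) : closure S r ->
  (forall i, {for r, continuous (c i)}) ->
  (forall h, S h -> little_o_t (fun t => \sum_i m i t * c i h)) ->
  little_o_t (fun t => \sum_i m i t * c i r).
Proof.
move=> Sr cc.
apply: (little_o_closure (P := S)
  (Lam := fun c v => {for r, continuous c} /\ v = c r)) => [f d v w a [cr ->] [dr ->]|f v [cr ->] c0|i]//.
  split=> //.
  apply: (@continuousD _ _ _ f (fun x => a * d x)) => //.
  by apply: (@continuousM _ _ (cst a) d) => //; exact: cvg_cst.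
apply/eqP/negPn/negP => cr0.
have /cr [e /= e0 He] : nbhs (f r) [set y | y != 0].
  by apply: (open_nbhs_nbhs); split => //; exact: open_neq.
have [h [Sh hr]] := Sr _ (nbhsx_ballx r e e0).
by have := He h hr; rewrite /= c0// eqxx.
Qed.

(** Integration over [a, b] is encoded as the increment of some antiderivative. Relations on the
    open interval suffice: by the mean value theorem, a derivative vanishing there forces a zero
    increment. *)
Lemma little_o_closure_increment (T : finType) (m E E' : T -> R -> R) (a b : R) :
  a < b ->
  (forall i h, a <= h <= b -> is_derive h 1 (E i) (E' i h)) ->
  (forall h, a < h < b -> little_o_t (fun t => \sum_i m i t * E' i h)) ->
  little_o_t (fun t => \sum_i m i t * (E i b - E i a)).
Proof.
move=> ab EE'.
apply: (little_o_closure (P := fun h => a < h < b)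
  (Lam := fun c v => exists F : R -> R,
     (forall h, a <= h <= b -> is_derive h 1 F (c h)) /\ v = F b - F a))
  => [c d v w k [F [Fc ->]] [G [Gd ->]]|c v [F [Fc ->]] c0|i].
- exists (fun x => F x + k * G x); split; last by ring.
  by move=> h hab; exact: (is_deriveD (Fc h hab) (is_deriveZ k (Gd h hab))).
- have cF : {within `[a, b], continuous F}.
    by apply: derivable_within_continuous => x; rewrite in_itv => /Fc[].
  have dF x : x \in `]a, b[ -> is_derive x 1 F (c x).
    by rewrite in_itv => /andP[ax xb]; apply: Fc; rewrite !ltW.
  have [h] := MVT ab dF cF.
  by rewrite in_itv /= => hab ->; rewrite c0// mul0r.
- by exists (E i); split => // h; exact: EE'.
Qed.

End Closure.

(** * Finite expansions uniform near a standard point *)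

Section Expansion.
Context {R : realType}.

(** [rho] is fixed before [e], and [d] does not depend on [h]: later [h] is replaced by points that
    move with [t]. *)
Definition uniform_little_o (x0 : R) (G : R -> R -> R) :=
  exists2 rho : R, 0 < rho & forall e, 0 < e -> exists2 d : R, 0 < d &
    forall t h, 0 <= t -> t < d -> `|h - x0| < rho -> `|G t h| <= e * t.

(** [A] records where the [e i] come from. In [expansion] they are iterated derivatives of [g] along
    [z], which later makes them differentiable in [h] to every order. *)
Definition expandable (x0 : R) (A : (R -> R) -> Prop) (G : R -> R -> R) :=
  exists (T : finType) (m e : T -> R -> R), [/\ forall i, bounded0 (m i),
    forall i, A (e i) &
    uniform_little_o x0 (fun t h => G t h - \sum_i m i t * e i h)].

Lemma uniform_little_o_eq x0 F G : (forall t h, F t h = G t h) ->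
  uniform_little_o x0 F -> uniform_little_o x0 G.
Proof. by move=> FG; have -> : F = G by do 2!apply/funext => ?. Qed.

Lemma uniform_little_oD x0 F G :
  uniform_little_o x0 F -> uniform_little_o x0 G ->
  uniform_little_o x0 (fun t h => F t h + G t h).
Proof.
move=> [r r0 H] [r' r'0 H']; exists (Num.min r r'); first by rewrite lt_min r0.
move=> e e0; have e20 : 0 < e / 2 by rewrite divr_gt0.
have [d d0 {}H] := H _ e20; have [d' d'0 {}H'] := H' _ e20.
exists (Num.min d d'); first by rewrite lt_min d0 d'0.
move=> t h t0; rewrite !lt_min => /andP[td td'] /andP[hr hr'].
apply: (le_trans (ler_normD _ _)).
by have := lerD (H t h t0 td hr) (H' t h t0 td' hr'); rewrite -mulrDl -splitr.
Qed.

Lemma uniform_little_oM x0 m G : bounded0 m -> uniform_little_o x0 G ->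
  uniform_little_o x0 (fun t h => m t * G t h).
Proof.
move=> /bounded0_pos[C C0 [d d0 H]] [r r0 HG]; exists r => // e e0.
have [d' d'0 H'] := HG _ (divr_gt0 e0 C0).
exists (Num.min d d'); first by rewrite lt_min d0 d'0.
move=> t h t0; rewrite !lt_min => /andP[td td'] hr.
rewrite normrM; have := ler_pM (normr_ge0 _) (normr_ge0 _) (H t t0 td) (H' t h t0 td' hr).
by move=> /le_trans; apply; rewrite mulrA mulrCA divff ?gt_eqF// mulr1.
Qed.

Lemma expandable_single x0 (A : (R -> R) -> Prop) e : A e ->
  expandable x0 A (fun t h => e h).
Proof.
move=> Ae; exists unit, (fun _ _ => 1), (fun _ => e); split => // [i|].
  exact: bounded0_cst.
exists 1 => // eps eps0; exists 1 => // t h t0 _ _.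
by rewrite (big_pred1 tt)// ?mul1r ?subrr ?normr0 ?mulr_ge0// ?ltW//; case.
Qed.

Lemma expandable_o x0 (A : (R -> R) -> Prop) F G : uniform_little_o x0 (fun t h => G t h - F t h) ->
  expandable x0 A F -> expandable x0 A G.
Proof.
move=> oGF [T [m [e [bm Ae oF]]]]; exists T, m, e; split => //.
by apply: uniform_little_o_eq (uniform_little_oD oGF oF) => t h; rewrite addrA subrK.
Qed.

Lemma expandable0 x0 (A : (R -> R) -> Prop) : expandable x0 A (fun _ _ => 0).
Proof.
exists void, (fun _ _ => 0), (fun _ _ => 0); split; try by case.
exists 1 => // e e0; exists 1 => // t h t0 _ _.
by rewrite big_pred0 ?subr0 ?normr0 ?mulr_ge0// ?ltW//; case.
Qed.

Lemma expandableD x0 (A : (R -> R) -> Prop) F G : expandable x0 A F ->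
  expandable x0 A G -> expandable x0 A (fun t h => F t h + G t h).
Proof.
move=> [T [m [e [bm Ae oF]]]] [T' [m' [e' [bm' Ae' oG]]]].
exists (T + T')%type, (fun i => match i with inl i => m i | inr i => m' i end),
  (fun i => match i with inl i => e i | inr i => e' i end); split; try by case.
apply: uniform_little_o_eq (uniform_little_oD oF oG) => t h.
by rewrite big_sumType /= opprD addrACA.
Qed.

Lemma expandableM x0 (A : (R -> R) -> Prop) f F : bounded0 f -> expandable x0 A F ->
  expandable x0 A (fun t h => f t * F t h).
Proof.
move=> bf [T [m [e [bm Ae oF]]]].
exists T, (fun i t => f t * m i t), e; split => // [i|]; first exact: bounded0M.
apply: uniform_little_o_eq (uniform_little_oM bf oF) => t h.
by rewrite mulrBr mulr_sumr; congr (_ - _); apply: eq_bigr => i _; rewrite mulrA.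
Qed.

Lemma expandable_sum x0 (A : (R -> R) -> Prop) N (F : nat -> R -> R -> R) :
  (forall k, expandable x0 A (F k)) ->
  expandable x0 A (fun t h => \sum_(k < N) F k t h).
Proof.
move=> EF; elim: N => [|N IHN].
  have -> : (fun t h => \sum_(k < 0) F k t h) = (fun _ _ => 0).
    by do 2!apply/funext => ?; rewrite big_ord0.
  exact: expandable0.
have -> : (fun t h => \sum_(k < N.+1) F k t h) =
    (fun t h => \sum_(k < N) F k t h + F N t h).
  by do 2!apply/funext => ?; rewrite big_ord_recr.
exact: expandableD.
Qed.

Lemma expandable_sub x0 (A B : (R -> R) -> Prop) F : (forall e, A e -> B e) ->
  expandable x0 A F -> expandable x0 B F.
Proof.
by move=> AB [T [m [e [bm Ae oF]]]]; exists T, m, e; split => // i; exact: AB.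
Qed.

Lemma is_derive_line (V : normedModType R) (g : V -> R^o) (w v : V) (s : R) :
  derivable g (w + s *: v) v ->
  is_derive s 1 (fun s : R => g (w + s *: v)) ('D_v g (w + s *: v)).
Proof.
rewrite /derivable /derive => dg.
have E : (fun h : R => h^-1 *: (((fun s0 : R => g (w + s0 *: v)) \o shift s) (h *: (1:R)) -
     g (w + s *: v))) =
   (fun h : R => h^-1 *: ((g \o shift (w + s *: v)) (h *: v) - g (w + s *: v))).
  apply/funext => h /=; congr (_ *: (g _ - _)).
  by rewrite scaler1 scalerDl addrCA.
by apply: DeriveDef; rewrite /derivable /derive E.
Qed.

Lemma iter_dir_cat (V : normedModType R) (vs ws : seq V) (g : V -> R^o) :
  iter_dir vs (iter_dir ws g) = iter_dir (vs ++ ws) g.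
Proof. by rewrite /iter_dir foldr_cat. Qed.

Lemma smooth_on_iter_dir (V : normedModType R) (U : set V) (g : V -> R^o) ws :
  smooth_on U g -> smooth_on U (iter_dir ws g).
Proof. by move=> sg vs x Ux; rewrite iter_dir_cat; exact: sg. Qed.

Lemma vanishing_sum (I : Type) (l : seq I) (F : I -> R -> R) :
  (forall i, vanishing (F i)) -> vanishing (fun t => \sum_(i <- l) F i t).
Proof.
move=> vF; elim: l => [|i l IHl] e e0.
  by exists 1 => // t _ _; rewrite big_nil normr0 ltW.
have e20 : 0 < e / 2 by rewrite divr_gt0.
have [d d0 H] := vF i _ e20; have [d' d'0 H'] := IHl _ e20.
exists (Num.min d d'); first by rewrite lt_min d0 d'0.
move=> t t0; rewrite lt_min => /andP[td td'].
rewrite big_cons (splitr e); apply: (le_trans (ler_normD _ _)).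
by apply: lerD; [exact: H|exact: H'].
Qed.

Lemma vanishing_normM (c : R) (f : R -> R) : vanishing f -> vanishing (fun t => `|f t| * `|c|).
Proof.
move=> vf e e0; have c0 : 0 < `|c| + 1 by rewrite ltr_wpDl.
have [d d0 H] := vf _ (divr_gt0 e0 c0); exists d => // t t0 td.
rewrite normrM !normr_id; apply: (@le_trans _ _ (`|f t| * (`|c| + 1))).
  by rewrite ler_wpM2l// lerDl.
by rewrite -ler_pdivlMr// H.
Qed.

(** [w] is only bounded by the sum, not equal to a given combination, so that all intermediate
    points of the Taylor segments are covered as well. *)
Lemma perturbation_near (V : normedModType R) (z : R -> V) (x0 : R) (W : set V)
    (I : Type) (l : seq I) (v : I -> V) (de : I -> R -> R) :
  {for x0, continuous z} -> (forall i, vanishing (de i)) -> nbhs (z x0) W ->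
  exists2 rho : R, 0 < rho & exists2 d : R, 0 < d & forall t h w,
    0 <= t -> t < d -> `|h - x0| < rho ->
    `|w| <= \sum_(j <- l) `|de j t| * `| `|v j| | -> W (z h + w).
Proof.
move=> cz vde /nbhs_ballP[r /= r0 Hr].
have r20 : 0 < r / 2 by rewrite divr_gt0.
have r40 : 0 < r / 4 by rewrite divr_gt0.
have [rho /= rho0 Hrho] : nbhs x0 [set h | `|z h - z x0| < r / 2].
  apply: (cz [set w | `|w - z x0| < r / 2]).
  by apply/nbhs_ballP; exists (r / 2) => //= y; rewrite -ball_normE /= distrC.
have [d d0 Hd] := vanishing_sum l (fun i => vanishing_normM `|v i| (vde i)) r40.
exists rho => //; exists d => // t h w t0 td hr wle.
apply: Hr; rewrite -ball_normE /= distrC addrAC (splitr r).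
apply: (le_lt_trans (ler_normD _ _)).
apply: ltr_leD; first by apply: Hrho; rewrite /= distrC.
apply: (le_trans wle); have := Hd t t0 td.
rewrite ger0_norm; last by apply: sumr_ge0 => j _; exact: mulr_ge0.
by move=> /le_trans; apply; lra.
Qed.

(** One direction is treated at a time. Taylor's formula along [v i] is cut at the order [N] with
    de_i^N = o(t), and the derivative of order [N] is bounded near [z x0], so the remainder is
    uniformly o(t). The remaining derivatives are again smooth, and the induction expands them in
    the other directions. *)
Lemma expansion (V : normedModType R) (U : set V) (z : R -> V) (x0 : R)
    (I : Type) (l : seq I) (v : I -> V) (de : I -> R -> R) (g : V -> R^o) :
  open U -> U (z x0) -> {for x0, continuous z} ->
  (forall i, nilpotent0 (de i)) -> smooth_on U g ->
  expandable x0 (fun e => exists vs, forall h, e h = iter_dir vs g (z h))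
    (fun t h => g (z h + \sum_(i <- l) de i t *: v i)).
Proof.
move=> oU Uz cz nde; elim: l g => [|i l IHl] g sg.
  have -> : (fun t h => g (z h + \sum_(i <- [::]) de i t *: v i)) = (fun _ h => g (z h)).
    by do 2!apply/funext => ?; rewrite big_nil addr0.
  by apply: expandable_single; exists [::].
have [N oN] := nde i.
have [C C0 HC] : exists2 C : R, 0 < C &
    nbhs (z x0) (U `&` [set w | `|iter_dir (nseq N (v i)) g w| <= C]).
  set gN := iter_dir _ g.
  have cg : {for z x0, continuous gN} by have [] := sg (nseq N (v i)) _ Uz.
  exists (`|gN (z x0)| + 1); first by rewrite ltr_wpDl.
  apply: filterI; first exact: open_nbhs_nbhs.
  apply: (cg [set y : R | `|y| <= `|gN (z x0)| + 1]).
  exists 1 => //= y yB; have {}yB : `|gN (z x0) - y| < 1 by [].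
  have := ler_normD (gN (z x0)) (y - gN (z x0)); rewrite addrC subrK => /le_trans; apply.
  by rewrite lerD2l distrC ltW.
have [rho rho0 [d1 d10 Hd1]] :=
  perturbation_near (i :: l) v cz (fun i => nilpotent0_vanishing (nde i)) HC.
(* The base point of the Taylor expansion along [v i], already displaced in the directions of
   [l]. *)
pose zz t h := z h + \sum_(i <- l) de i t *: v i.
have inball t h s : 0 <= t -> t < d1 -> `|h - x0| < rho -> `|s| <= `|de i t| ->
    U (zz t h + s *: v i) /\ `|iter_dir (nseq N (v i)) g (zz t h + s *: v i)| <= C.
  move=> t0 td hr sd; rewrite /zz -addrA; apply: (Hd1 t) => //.
  rewrite big_cons addrC; apply: (le_trans (ler_normD _ _)); apply: lerD.
    by rewrite normrZ normr_id ler_wpM2r.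
  apply: (le_trans (ler_norm_sum _ _ _)); apply: ler_sum => j _.
  by rewrite normrZ normr_id.
apply: (@expandable_o _ _ (fun t h => \sum_(k < N) (de i t ^+ k / k`!%:R) *
   iter_dir (nseq k (v i)) g (zz t h))); last first.
  apply: (@expandable_sum x0 _ N (fun k t h => (de i t ^+ k / k`!%:R) *
   iter_dir (nseq k (v i)) g (zz t h))) => k.
  apply: (@expandableM x0 _ (fun t => de i t ^+ k / k`!%:R)).
    apply: bounded0M; last exact: bounded0_cst.
    exact/bounded0X/vanishing_bounded0/nilpotent0_vanishing.
  apply: expandable_sub (IHl _ (smooth_on_iter_dir (nseq k (v i)) sg)).
  by move=> e [vs He]; exists (vs ++ nseq k (v i)) => h; rewrite He iter_dir_cat.
exists rho => // e e0.
have [d2 d20 Hd2] := oN _ (divr_gt0 e0 C0).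
exists (Num.min d1 d2); first by rewrite lt_min d10.
move=> t h t0; rewrite lt_min => /andP[td1 td2] hr.
pose F k (s : R) : R := iter_dir (nseq k (v i)) g (zz t h + s *: v i).
have mm s : s \in `[Num.min 0 (de i t), Num.max 0 (de i t)] -> `|s| <= `|de i t|.
  rewrite in_itv /=; case: (leP 0 (de i t)) => d0 /andP[s1 s2].
    by rewrite !ger0_norm.
  by rewrite !ler0_norm ?lerN2// ltW.
have := @taylor_bound R F N 0 (de i t) C.
rewrite /taylor subr0 => H.
have -> : g (z h + \sum_(j <- i :: l) de j t *: v j) = F 0%N (de i t).
  by rewrite /F /zz /= big_cons -addrA [in RHS](addrC (\sum_(i <- l) _)).
rewrite (eq_bigr (fun k : 'I_N => F k 0 * (de i t) ^+ k / k`!%:R)); last first.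
  by move=> k _; rewrite /F scale0r addr0 mulrC mulrA.
have HF k x : (k < N)%N -> x \in `[Num.min 0 (de i t), Num.max 0 (de i t)] ->
    is_derive x 1 (F k) (F k.+1 x).
  move=> kN /mm xs; rewrite /F /=.
  apply: is_derive_line.
  have [Uw _] := inball t h x t0 td1 hr xs.
  by have [/(_ (v i))] := sg (nseq k (v i)) _ Uw.
have HN x : x \in `[Num.min 0 (de i t), Num.max 0 (de i t)] -> `|F N x| <= C.
  by move=> /mm xs; have [] := inball t h x t0 td1 hr xs.
have {H} := H HF HN; move=> /le_trans; apply.
have := Hd2 t t0 td2; rewrite normrX -(ler_pM2l C0) => /le_trans; apply.
by rewrite mulrA mulrCA divff ?gt_eqF// mulr1.
Qed.

End Expansion.

(** * The ordered group of Fermat reals *)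

Section FermatRealTheory.
Context {R : realType}.
Implicit Types (x y : R -> R) (X Y Z : FR R) (s : seq (R * R)).

Lemma little_o_expr_ge (f : R -> R) N K : (N <= K)%N ->
  little_o_t (fun t => f t ^+ N) -> little_o_t (fun t => f t ^+ K).
Proof.
move=> NK oN; have [|d d0 H] := @nilpotent0_vanishing R f _ 1 ltr01; first by exists N.
apply: little_o_dom oN; exists 1, d => // t t0 td.
by rewrite mul1r !normrX ler_wiXn2l// H.
Qed.

Lemma norm_exprD_le (a b : R) K :
  `|a + b| ^+ K <= 2 ^+ K * (`|a| ^+ K + `|b| ^+ K).
Proof.
wlog ab : a b / `|a| <= `|b|.
  move=> H; have [/H//|/ltW/H] := leP `|a| `|b|.
  by rewrite [b + a]addrC [X in _ * X]addrC.
apply: (@le_trans _ _ ((2 * `|b|) ^+ K)).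
  rewrite lerXn2r ?nnegrE ?mulr_ge0//; apply: (le_trans (ler_normD _ _)).
  by rewrite mulr_natl mulr2n lerD2r.
by rewrite exprMn ler_wpM2l ?exprn_ge0// lerDr exprn_ge0.
Qed.

(** The larger of the two exponents already works, since |a + b|^K is at most 2^K (|a|^K +
    |b|^K). *)
Lemma nilpotent0D (f g : R -> R) : nilpotent0 f -> nilpotent0 g ->
  nilpotent0 (fun t => f t + g t).
Proof.
move=> [N oN] [M oM]; set K := maxn N M.
have oNK := little_o_expr_ge (leq_maxl N M) oN.
have oMK := little_o_expr_ge (leq_maxr N M) oM.
have norm (h : R -> R) : little_o_t h -> little_o_t (fun t => `|h t|).
  by apply: little_o_dom; exists 1, 1 => // t _ _; rewrite normr_id mul1r.
exists K; have := little_oD (norm _ oNK) (norm _ oMK); apply: little_o_dom.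
exists (2 ^+ K), 1 => // t _ _; rewrite !normrX.
by rewrite [X in _ * X]ger0_norm ?addr_ge0 ?exprn_ge0// norm_exprD_le.
Qed.

Lemma nilpotent0Z (c : R) (f : R -> R) : nilpotent0 f -> nilpotent0 (fun t => c * f t).
Proof.
move=> [N oN]; exists N; apply: little_o_eq (little_oZ (c ^+ N) oN) => t.
by rewrite exprMn.
Qed.

Lemma nilpotent0_sum (I : eqType) (l : seq I) (F : I -> R -> R) :
  (forall i, i \in l -> nilpotent0 (F i)) -> nilpotent0 (fun t => \sum_(i <- l) F i t).
Proof.
elim: l => [|i l IHl] nF.
  exists 1%N; apply: little_o_eq (@little_o0 R) => t.
  by rewrite big_nil expr0n.
have [|N oN] := @nilpotent0D (F i) (fun t => \sum_(i <- l) F i t) (nF i (mem_head _ _)).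
  by apply: IHl => j jl; apply: nF; rewrite inE jl orbT.
by exists N; apply: little_o_eq oN => t; rewrite big_cons.
Qed.

Lemma tpow0 (t : R) : tpow t 0 = 1.
Proof. by rewrite /tpow eqxx powRr0; case: ifP. Qed.

Lemma tpow_0 (a : R) : a != 0 -> tpow 0 a = 0.
Proof. by rewrite /tpow eqxx => /negbTE ->. Qed.

Lemma tpow_ge0 (t a : R) : 0 <= tpow t a.
Proof. by rewrite /tpow; case: ifP => _; [case: ifP|exact: powR_ge0]. Qed.

Lemma tpow_split (t a b : R) : 0 <= t -> 0 <= a -> a < b -> tpow t b = tpow t a * tpow t (b - a).
Proof.
move=> t0 a0 ab; have [->|tn0] := eqVneq t 0.
  have bn0 : b != 0 by rewrite gt_eqF// (le_lt_trans a0).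
  have ban0 : b - a != 0 by rewrite subr_eq0 gt_eqF.
  by rewrite (tpow_0 bn0) (tpow_0 ban0) mulr0.
rewrite /tpow (negbTE tn0) -powRD ?tn0 ?implybT//.
by rewrite addrCA subrr addr0.
Qed.

Lemma tpow_nilpotent0 (a : R) : 0 < a -> nilpotent0 (fun t : R => tpow t a).
Proof.
(* Chosen so that [a * N%:R] is at least 2: then t^(aN) is at most t^2, which is at most e t once t
   < min(1, e). *)
move=> a0; pose N := (Num.trunc (2 / a)).+1.
have Na : 2 <= a * N%:R.
  by rewrite mulrC -ler_pdivrMr// ltW// truncnS_gt.
exists N => e e0; exists (Num.min 1 e); first by rewrite lt_min ltr01.
move=> t t0; rewrite lt_min => /andP[t1 te].
have [->|tn0] := eqVneq t 0; first by rewrite tpow_0 ?gt_eqF// expr0n /= normr0 mulr0.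
have tgt0 : 0 < t by rewrite lt_neqAle eq_sym tn0.
rewrite ger0_norm ?exprn_ge0 ?tpow_ge0// /tpow (negbTE tn0).
rewrite -powR_mulrn ?powR_ge0// -powRrM.
apply: (@le_trans _ _ (t `^ 2)).
  by apply: ger_powR => //; rewrite tgt0 ltW.
by rewrite powR_mulrn// expr2 ler_wpM2r// ltW.
Qed.

Lemma Ro_nilpotent0 x : Ro x -> nilpotent0 (fun t => x t - x 0).
Proof.
move=> [r [s [s0 os]]].
(* An o(t) map vanishes at 0, so [x 0] is [r] plus the value at 0 of the power sum, and only
   differences of powers remain. *)
have := little_o_at0 os => /= x0.
have [|N oN] := @nilpotent0D _ _ (little_o_nilpotent0 os) (@nilpotent0_sum _ s
  (fun p t => p.1 * (tpow t p.2 - tpow 0 p.2)) _).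
  move=> p ps; apply: (@nilpotent0Z _ (fun t => tpow t p.2 - tpow 0 p.2)).
  have [->|p0] := eqVneq p.2 0.
    exists 1%N; apply: little_o_eq (@little_o0 R) => t.
    by rewrite !tpow0 subrr expr0n.
  have [|N oN] := @tpow_nilpotent0 p.2; first by rewrite lt_neqAle eq_sym p0 s0.
  by exists N; apply: little_o_eq oN => t; rewrite (tpow_0 p0) subr0.
exists N; apply: little_o_eq oN => t; congr (_ ^+ _).
have -> : \sum_(p <- s) p.1 * (tpow t p.2 - tpow 0 p.2) =
    \sum_(p <- s) p.1 * tpow t p.2 - \sum_(p <- s) p.1 * tpow 0 p.2.
  by rewrite -sumrB; apply: eq_bigr => p _; rewrite mulrBr.
move: x0; move: (\sum_(p <- s) p.1 * tpow 0 p.2) (\sum_(p <- s) p.1 * tpow t p.2) => S S'.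
by move: (x 0) (x t) => a b; lra.
Qed.

Lemma RoD x y : Ro x -> Ro y -> Ro (fun t => x t + y t).
Proof.
move=> [r [s [s0 os]]] [r' [s' [s'0 os']]]; exists (r + r'), (s ++ s'); split.
  by move=> p; rewrite mem_cat => /orP[/s0|/s'0].
apply: little_o_eq (little_oD os os') => t; rewrite big_cat /=; ring.
Qed.

Lemma RoZ (c : R) x : Ro x -> Ro (fun t => c * x t).
Proof.
move=> [r [s [s0 os]]]; exists (c * r), [seq (c * p.1, p.2) | p <- s]; split.
  by move=> p /mapP[q /s0 q0 ->].
apply: little_o_eq (little_oZ c os) => t; rewrite big_map !mulrBr mulr_sumr.
by congr (_ - _); apply: eq_bigr => p _; rewrite mulrA.
Qed.

Lemma RoN x : Ro x -> Ro (fun t => - x t).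
Proof.
move=> /(RoZ (-1)); have -> // : (fun t => -1 * x t) = (fun t => - x t).
by apply/funext => t; rewrite mulN1r.
Qed.

Lemma RoB x y : Ro x -> Ro y -> Ro (fun t => x t - y t).
Proof. by move=> Rx /RoN; exact: RoD. Qed.

Lemma Ro_cst (r : R) : Ro (fun=> r).
Proof.
exists r, [::]; split=> //.
by apply: little_o_eq (@little_o0 R) => t; rewrite big_nil !subr0 subrr.
Qed.

Lemma Ro_little_o x : little_o_t x -> Ro x.
Proof.
move=> H; exists 0, [::]; split=> //.
by apply: little_o_eq H => t; rewrite big_nil !subr0.
Qed.

Lemma FR_eqP X Y : X = Y <-> little_o_t (fun t => rep X t - rep Y t).
Proof.
split=> [->|o].
  by apply: little_o_eq (@little_o0 R) => t; rewrite subrr.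
move: o; rewrite /rep; case: cid => x [Rx Xx]; case: cid => y [Ry Yy] /= o.
apply: eq_sig_hprop; first by move=> *; exact: Prop_irrelevance.
rewrite Xx Yy; apply/funext => z; apply/propext.
split=> -[Rz oz]; split => //.
  by apply: little_o_eq (little_oD oz o) => t; rewrite addrA subrK.
by apply: little_o_eq (little_oB oz o) => t; ring.
Qed.

Lemma Ro_rep X : Ro (rep X).
Proof. by rewrite /rep; case: cid => x []. Qed.

Lemma is_repP X x : is_rep X x <-> Ro x /\ little_o_t (fun t => x t - rep X t).
Proof.
by rewrite /is_rep /rep; case: cid => y [Ry Xy] /=; move: Xy => ->.
Qed.

Lemma is_rep_cls x : Ro x -> is_rep (cls x) x.
Proof.
rewrite /cls; case: pselect => // Rx _; split => //.
by apply: little_o_eq (@little_o0 R) => t; rewrite subrr.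
Qed.

Lemma rep_cls x : Ro x -> little_o_t (fun t => rep (cls x) t - x t).
Proof.
move=> /is_rep_cls/is_repP[_ /little_oN].
by apply: little_o_eq => t; rewrite opprB.
Qed.

Lemma stdp_is_rep X x : is_rep X x -> stdp X = x 0.
Proof.
move=> /is_repP[_ /little_o_at0/eqP]; rewrite subr_eq0 => /eqP -> //.
Qed.

Lemma nilpotent0_rep X : nilpotent0 (fun t => rep X t - stdp X).
Proof. exact/Ro_nilpotent0/Ro_rep. Qed.

Definition cstFR (r : R) : FR R := cls (fun=> r).

Lemma stdp_cstFR (r : R) : stdp (cstFR r) = r.
Proof. exact: (stdp_is_rep (is_rep_cls (Ro_cst r))). Qed.

Lemma rep_cstFR (r : R) : little_o_t (fun t => rep (cstFR r) t - r).
Proof. exact: rep_cls (Ro_cst r). Qed.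

Definition oppFR X : FR R := cls (fun t => - rep X t).

Lemma rep_addFR X Y : little_o_t (fun t => rep (addFR X Y) t - (rep X t + rep Y t)).
Proof. by apply: rep_cls; apply: RoD; exact: Ro_rep. Qed.

Lemma rep_oppFR X : little_o_t (fun t => rep (oppFR X) t + rep X t).
Proof.
by apply: little_o_eq (rep_cls (RoN (Ro_rep X))) => t; rewrite opprK.
Qed.

Lemma rep_fr0 : little_o_t (rep (fr0 R)).
Proof.
have /is_repP[_ /little_oN] : is_rep (fr0 R) (fun=> 0).
  by split; [exact: Ro_cst|apply: little_o_eq (@little_o0 R) => t; rewrite subrr].
by apply: little_o_eq => t; rewrite sub0r opprK.
Qed.

Lemma addFRA : associative (@addFR R).
Proof.
move=> X Y Z; apply/FR_eqP.
have := little_oB (little_oD (rep_addFR X (addFR Y Z)) (rep_addFR Y Z))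
  (little_oD (rep_addFR (addFR X Y) Z) (rep_addFR X Y)).
by apply: little_o_eq => t; ring.
Qed.

Lemma addFRC : commutative (@addFR R).
Proof.
by move=> X Y; rewrite /addFR; congr cls; apply/funext => t; rewrite addrC.
Qed.

Lemma add0FR : left_id (fr0 R) (@addFR R).
Proof.
move=> X; apply/FR_eqP; have := little_oD (rep_addFR (fr0 R) X) rep_fr0.
by apply: little_o_eq => t; ring.
Qed.

Lemma addNFR : left_inverse (fr0 R) oppFR (@addFR R).
Proof.
move=> X; apply/FR_eqP.
have := little_oB (little_oD (rep_addFR (oppFR X) X) (rep_oppFR X)) rep_fr0.
by apply: little_o_eq => t; ring.
Qed.

(** Trades the auxiliary negligible map for an epsilon. Conversely, the positive part of the
    difference of representatives is such a map. *)
Lemma leFRP X Y : leFR X Y <-> forall e : R, 0 < e -> exists2 d : R, 0 < d &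
  forall t, 0 <= t -> t < d -> rep X t - rep Y t <= e * t.
Proof.
split=> [[z [_ oz [d d0 H]]] e e0|H].
  have {}oz : little_o_t z by apply: little_o_eq oz => t; rewrite subr0.
  have [d' d'0 H'] := oz e e0; exists (Num.min d d'); first by rewrite lt_min d0.
  move=> t t0; rewrite lt_min => /andP[td td'].
  rewrite lerBlDl; apply: (le_trans (H t t0 td)).
  by rewrite lerD2l; apply: le_trans (H' t t0 td'); exact: ler_norm.
pose z t : R := Num.max 0 (rep X t - rep Y t).
have oz : little_o_t z.
  move=> e e0; have [d d0 Hd] := H e e0; exists d => // t t0 td.
  rewrite ger0_norm ?le_max ?lexx// ge_max Hd// andbT.
  by rewrite mulr_ge0// ltW.
exists z; split; first exact: Ro_little_o.
  by apply: little_o_eq oz => t; rewrite subr0.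
by exists 1 => // t _ _; rewrite -lerBlDl le_max lexx orbT.
Qed.

Lemma leFR_near X Y : (exists2 d : R, 0 < d & forall t, 0 <= t -> t < d -> rep X t <= rep Y t) ->
  leFR X Y.
Proof.
move=> [d d0 H]; apply/leFRP => e e0; exists d => // t t0 td.
apply: (@le_trans _ _ 0); first by rewrite subr_le0 H.
by rewrite mulr_ge0// ltW.
Qed.

Lemma leFR_refl X : leFR X X.
Proof. by apply: leFR_near; exists 1. Qed.

Lemma leFR_trans Y X Z : leFR X Y -> leFR Y Z -> leFR X Z.
Proof.
move=> /leFRP XY /leFRP YZ; apply/leFRP => e e0.
have e20 : 0 < e / 2 by rewrite divr_gt0.
have [d d0 H] := XY _ e20; have [d' d'0 H'] := YZ _ e20.
exists (Num.min d d'); first by rewrite lt_min d0.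
move=> t t0; rewrite lt_min => /andP[td td'].
by have := lerD (H t t0 td) (H' t t0 td'); rewrite addrA subrK -mulrDl -splitr.
Qed.

Lemma leFR_anti X Y : leFR X Y -> leFR Y X -> X = Y.
Proof.
move=> /leFRP XY /leFRP YX; apply/FR_eqP => e e0.
have [d d0 H] := XY _ e0; have [d' d'0 H'] := YX _ e0.
exists (Num.min d d'); first by rewrite lt_min d0.
move=> t t0; rewrite lt_min => /andP[td td'].
by rewrite ler_norml H// andbT lerNl opprB H'.
Qed.

Lemma leFR_stdp X Y : leFR X Y -> stdp X <= stdp Y.
Proof.
move=> /leFRP/(_ 1 ltr01)[d d0 /(_ 0 (lexx _) d0)].
by rewrite mulr0 subr_le0.
Qed.

Lemma stdp_lt_leFR X Y : stdp X < stdp Y -> leFR X Y.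
Proof.
move=> XY; apply: leFR_near.
have e0 : 0 < (stdp Y - stdp X) / 2 by rewrite divr_gt0// subr_gt0.
have [d d0 H] := nilpotent0_vanishing (nilpotent0_rep X) e0.
have [d' d'0 H'] := nilpotent0_vanishing (nilpotent0_rep Y) e0.
exists (Num.min d d'); first by rewrite lt_min d0.
move=> t t0; rewrite lt_min => /andP[td td'].
have := H t t0 td; have := H' t t0 td'; rewrite !ler_norml => /andP[+ _] /andP[_ +].
by move: (rep X t) (rep Y t) => a b; lra.
Qed.

Lemma min_exponent (s : seq (R * R)) : s != [::] ->
  exists2 p, p \in s & forall q, q \in s -> p.2 <= q.2.
Proof.
elim: s => // p s IHs _; have [->|/IHs[q qs H]] := eqVneq s [::].
  by exists p; rewrite ?mem_head// => q; rewrite inE => /eqP ->.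
have [pq|/ltW qp] := leP p.2 q.2.
  exists p; rewrite ?mem_head// => r; rewrite inE => /predU1P[->//|/H].
  exact: le_trans.
exists q; first by rewrite inE qs orbT.
by move=> r; rewrite inE => /predU1P[->//|/H].
Qed.

(** The lowest exponent [a] decides. Let [A] be its total coefficient. If [A] is 0, those terms are
    dropped and the list is shorter; otherwise the sum is t^a (A + h) with [h] vanishing at 0+, and
    it has the sign of [A]. This is what makes the order total. *)
Lemma powers_sign s : (forall p, p \in s -> 0 <= p.2) ->
  exists2 d : R, 0 < d &
    (forall t, 0 <= t -> t < d -> 0 <= \sum_(p <- s) p.1 * tpow t p.2) \/
    (forall t, 0 <= t -> t < d -> \sum_(p <- s) p.1 * tpow t p.2 <= 0).
Proof.
have [n] := ubnP (size s); elim: n s => // n IHn s sn s0.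
have [s_nil|sN0] := eqVneq s [::].
  by exists 1 => //; left => t _ _; rewrite s_nil big_nil.
have [[c a] /= cas min_a] := min_exponent sN0.
have a0 : 0 <= a by exact: (s0 _ cas).
pose A := \sum_(p <- s | p.2 == a) p.1.
have splitA t : \sum_(p <- s) p.1 * tpow t p.2 =
    A * tpow t a + \sum_(p <- s | p.2 != a) p.1 * tpow t p.2.
  rewrite (bigID (fun p => p.2 == a)) /=; congr (_ + _).
  by rewrite mulr_suml; apply: eq_bigr => p /eqP ->.
have [A0|AN0] := eqVneq A 0.
  pose s' := [seq p <- s | p.2 != a].
  have [||d d0 H] := IHn s'.
  - apply: (@leq_trans (size s)); last exact: sn.
    rewrite size_filter -(count_predC (fun p => p.2 != a) s).
    rewrite -addn1 leq_add2l -has_count; apply/hasP.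
    by exists (c, a) => //=; rewrite eqxx.
  - by move=> p; rewrite mem_filter => /andP[_ /s0].
  exists d => //; case: H => H; [left|right] => t t0 td;
    by rewrite splitA A0 mul0r add0r -big_filter H.
pose h t := \sum_(p <- [seq p <- s | p.2 != a]) p.1 * tpow t (p.2 - a).
have vh : vanishing h.
  apply: nilpotent0_vanishing.
  apply: (@nilpotent0_sum _ _ (fun p t => p.1 * tpow t (p.2 - a))) => p.
  rewrite mem_filter => /andP[pa ps]; apply: (@nilpotent0Z _ (fun t => tpow t (p.2 - a))); apply: tpow_nilpotent0.
  by rewrite subr_gt0 lt_neqAle eq_sym pa min_a.
have qE t : 0 <= t -> \sum_(p <- s) p.1 * tpow t p.2 = tpow t a * (A + h t).
  move=> t0; rewrite splitA mulrDr mulrC; congr (_ + _).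
  rewrite /h -big_filter mulr_sumr; apply: eq_big_seq => p.
  rewrite mem_filter => /andP[pa ps].
  by rewrite (tpow_split t0 a0) 1?mulrCA// lt_neqAle eq_sym pa min_a.
have [d d0 H] : exists2 d : R, 0 < d & forall t, 0 <= t -> t < d -> `|h t| <= `|A|.
  by apply: vh; rewrite normr_gt0.
exists d => //; have [A0|A0] := leP 0 A; [left|right] => t t0 td; rewrite qE//.
  rewrite mulr_ge0 ?tpow_ge0//; have := H t t0 td.
  by rewrite (ger0_norm A0) ler_norml => /andP[+ _]; rewrite -subr_ge0 opprK addrC.
rewrite mulr_ge0_le0 ?tpow_ge0//; have := H t t0 td.
by rewrite (ltr0_norm A0) ler_norml -lerBrDl sub0r => /andP[].
Qed.

Lemma leFR_total X Y : leFR X Y \/ leFR Y X.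
Proof.
have [r [s [s0 os]]] := RoB (Ro_rep X) (Ro_rep Y).
(* The constant [r] enters as a term of exponent 0. *)
have [|d d0 H] := @powers_sign ((r, 0) :: s).
  by move=> p; rewrite inE => /predU1P[->//|/s0].
have {}os : little_o_t (fun t => rep X t - rep Y t -
    \sum_(p <- (r, 0) :: s) p.1 * tpow t p.2).
  by apply: little_o_eq os => t; rewrite big_cons /= tpow0; ring.
move: os H; set q := fun t => \sum_(p <- (r, 0) :: s) p.1 * tpow t p.2 => os [] H; [right|left].
  apply/leFRP => e e0; have [d' d'0 H'] := os e e0.
  exists (Num.min d d'); first by rewrite lt_min d0.
  move=> t t0; rewrite lt_min => /andP[td td'].
  have := H' t t0 td'; rewrite ler_norml => /andP[+ _].
  by have := H t t0 td; rewrite -/(q t); move: (q t) (rep X t) (rep Y t) (e * t) => *; lra.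
apply/leFRP => e e0; have [d' d'0 H'] := os e e0.
exists (Num.min d d'); first by rewrite lt_min d0.
move=> t t0; rewrite lt_min => /andP[td td'].
have := H' t t0 td'; rewrite ler_norml => /andP[_].
by have := H t t0 td; rewrite -/(q t); move: (q t) (rep X t) (rep Y t) (e * t) => *; lra.
Qed.

(** A test point strictly between two distinct points, even when they are infinitely close. *)
Definition midFR X Y : FR R := cls (fun t => 2^-1 * (rep X t + rep Y t)).

Lemma rep_midFR X Y :
  little_o_t (fun t => rep (midFR X Y) t - 2^-1 * (rep X t + rep Y t)).
Proof. by apply/rep_cls/RoZ/RoD; exact: Ro_rep. Qed.

Lemma leFR_mid X Y : leFR X Y -> leFR X (midFR X Y) /\ leFR (midFR X Y) Y.
Proof.
move=> /leFRP XY; split; apply/leFRP => e e0; have [d d0 H] := XY _ e0;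
  (have e20 : 0 < e / 2 by rewrite divr_gt0);
  have [d' d'0 H'] := rep_midFR X Y e20;
  (exists (Num.min d d'); first by rewrite lt_min d0);
  move=> t t0; rewrite lt_min => /andP[td td'];
  have := H t t0 td; have := H' t t0 td'; rewrite mulrAC ler_norml => /andP[];
  move: (rep X t) (rep Y t) (e * t) (rep (midFR X Y) t) => a b c m; lra.
Qed.

Lemma midFR_eql X Y : midFR X Y = X -> X = Y.
Proof.
move=> mX; apply/FR_eqP; have := rep_midFR X Y; rewrite mX => /(little_oZ 2).
by apply: little_o_eq => t; field.
Qed.

Lemma midFR_eqr X Y : midFR X Y = Y -> X = Y.
Proof.
move=> mY; apply/FR_eqP; have := rep_midFR X Y; rewrite mY => /(little_oZ (-2)).
by apply: little_o_eq => t; field.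
Qed.

End FermatRealTheory.

HB.instance Definition _ (R : realType) := gen_eqMixin (FR R).
HB.instance Definition _ (R : realType) := gen_choiceMixin (FR R).
(** The group law is [addFR] with neutral element [fr0], so the sums of the theorem are sums in this
    group by conversion. *)
HB.instance Definition _ (R : realType) := GRing.isZmodule.Build (FR R)
  (@addFRA R) (@addFRC R) (@add0FR R) (@addNFR R).

Lemma rep_subFR (R : realType) (X Y : FR R) :
  little_o_t (fun t => rep (X - Y) t - (rep X t - rep Y t)).
Proof.
have := little_oD (rep_addFR X (oppFR Y)) (rep_oppFR Y).
change (addFR X (oppFR Y)) with (X - Y).
by apply: little_o_eq => t; ring.
Qed.

Section FermatRealOrder.
Context {R : realType}.

Lemma leFRb_refl : reflexive (fun X Y : FR R => `[< leFR X Y >]).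
Proof. by move=> X; apply/asboolP; exact: leFR_refl. Qed.
Lemma leFRb_anti : antisymmetric (fun X Y : FR R => `[< leFR X Y >]).
Proof. by move=> X Y /andP[/asboolP ? /asboolP ?]; exact: leFR_anti. Qed.
Lemma leFRb_trans : transitive (fun X Y : FR R => `[< leFR X Y >]).
Proof. by move=> Y X Z /asboolP XY /asboolP YZ; apply/asboolP; exact: leFR_trans YZ. Qed.

HB.instance Definition _ := Order.Le_isPOrder.Build (Order.Disp tt tt) (FR R)
  leFRb_refl leFRb_anti leFRb_trans.

Lemma leFRb_total : total (<=%O : rel (FR R)).
Proof.
by move=> X Y; have [XY|YX] := leFR_total X Y; apply/orP; [left|right]; apply/asboolP.
Qed.

HB.instance Definition _ := Order.POrder_isTotal.Build (Order.Disp tt tt) (FR R) leFRb_total.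

Lemma leFRE (X Y : FR R) : (X <= Y)%O <-> leFR X Y.
Proof. by split=> /asboolP. Qed.

Lemma ltFRE (X Y : FR R) : (X < Y)%O <-> ltFR X Y.
Proof.
rewrite lt_neqAle; split=> [/andP[/eqP XY /asboolP]//|[? /eqP ->]].
by rewrite /=; apply/asboolP.
Qed.

Lemma midFR_lt (X Y : FR R) : (X < Y)%O -> (X < midFR X Y < Y)%O.
Proof.
move=> /ltFRE[XY XYn]; have [Xm mY] := leFR_mid XY.
apply/andP; split; apply/ltFRE; split=> // E; apply: XYn.
  exact/midFR_eql/esym.
exact/midFR_eqr.
Qed.

End FermatRealOrder.

(** * Expansions of local representations *)

Section DerivativeExpansion.
Context {R : realType}.

Lemma openX_prod (T U : topologicalType) (A : set T) (B : set U) :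
  open A -> open B -> open (A `*` B).
Proof.
move=> oA oB; rewrite openE => -[a b] [Aa Bb].
by exists (A, B) => //=; split; exact: open_nbhs_nbhs.
Qed.

Lemma primitive_exists (e : R -> R) (a rho : R) : 0 < rho ->
  (forall h, `|h - a| < rho -> {for h, continuous e}) ->
  exists F : R -> R, forall h, `|h - a| < rho / 2 -> is_derive h 1 F (e h).
Proof.
move=> rho0 ce.
(* The radius is halved so that the closed interval [[l, u]] stays where [e] is continuous, hence
   integrable. *)
pose l := a - rho / 2; pose u := a + rho / 2.
pose F x : R := (\int[@lebesgue_measure R]_(t in [set` `[l, x]]) (e t))%R.
have near_a h : l <= h <= u -> `|h - a| < rho.
  move=> /andP[lh hu]; apply: (@le_lt_trans _ _ (rho / 2)); last by lra.
  by rewrite ler_norml; move: lh hu; rewrite /l /u => ? ?; apply/andP; split; lra.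
have int_e : (@lebesgue_measure R).-integrable `[l, u] (EFin \o e).
  apply: continuous_compact_integrable; first exact: segment_compact.
  apply: continuous_in_subspaceT => x; rewrite inE /= in_itv /= => xlu.
  exact/ce/near_a.
exists F => h; rewrite ltr_norml => /andP[h1 h2].
have lh : l < h by rewrite /l; lra.
have hu : h < u by rewrite /u; lra.
have ceh : {for h, continuous e} by apply/ce/near_a; rewrite !ltW.
have [dF F'] := continuous_FTC1_closed hu int_e lh ceh.
by apply: DeriveDef; [exact: dF|rewrite -derive1E].
Qed.

Lemma is_derive_snd (V : normedModType R) (g : (V * R^o)%type -> R^o) (q : V) (h : R) :
  derivable g (q, h) (0, 1) ->
  is_derive h 1 (fun h : R => g (q, h)) ('D_((0 : V), (1 : R^o)) g (q, h)).
Proof.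
have E (s : R) : (q, 0) + s *: ((0 : V), (1 : R^o)) = (q, s).
  by congr (_, _) => /=; rewrite ?scaler0 ?addr0// add0r [LHS]mulr1.
have -> : (fun h : R => g (q, h)) = (fun s : R => g ((q, 0) + s *: (0, 1))).
  by apply/funext => s; rewrite E.
by rewrite -E; exact: is_derive_line.
Qed.

Lemma is_derive_lincomb (T : Type) (l : seq T) (c dF : T -> R) (F : T -> R -> R) (x : R) :
  (forall i, is_derive x 1 (F i) (dF i)) ->
  is_derive x 1 (fun h => \sum_(i <- l) c i * F i h) (\sum_(i <- l) c i * dF i).
Proof.
move=> HF; elim: l => [|i l IHl].
  have -> : (fun h => \sum_(i <- [::]) c i * F i h) = cst 0.
    by apply/funext => h; rewrite big_nil.
  by rewrite big_nil; exact: is_derive_cst.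
have -> : (fun h => \sum_(j <- i :: l) c j * F j h) =
    (c i \*: F i) + (fun h => \sum_(j <- l) c j * F j h).
  by apply/funext => h; rewrite big_cons.
by rewrite big_cons; exact: (is_deriveD (is_deriveZ _ (HF i)) IHl).
Qed.

Lemma rep_near (Y : FR R) (a rho : R) : `|stdp Y - a| < rho ->
  exists2 d : R, 0 < d & forall t, 0 <= t -> t < d -> `|rep Y t - a| < rho.
Proof.
move=> Ya; have e0 : 0 < (rho - `|stdp Y - a|) / 2 by rewrite divr_gt0// subr_gt0.
have [d d0 H] := nilpotent0_vanishing (nilpotent0_rep Y) e0.
exists d => // t t0 td.
have -> : rep Y t - a = (rep Y t - stdp Y) + (stdp Y - a) by rewrite addrA subrK.
apply: (le_lt_trans (ler_normD _ _)); have := H t t0 td; move: Ya.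
by move: `|rep Y t - stdp Y| `|stdp Y - a| => A B; lra.
Qed.

Lemma between_near (a b c rho h : R) : h \in `[Num.min a b, Num.max a b] ->
  `|a - c| < rho -> `|b - c| < rho -> `|h - c| < rho.
Proof.
rewrite in_itv /= ge_min le_max !ltr_norml => hab /andP[a1 a2] /andP[b1 b2].
by case/andP: hab => /orP[] h1 /orP[] h2; apply/andP; split; lra.
Qed.

(** Puts a parameter in the form required by [expansion]: a fixed point plus nilpotent multiples of
    the coordinate directions. *)
Lemma repv_decomp (pp : nat) (p : 'I_pp -> FR R) (t h : R) :
  (stdv p, h) + \sum_i (rep (p i) t - stdp (p i)) *: ((delta_mx 0 i : 'rV[R]_pp), (0 : R^o))
  = (repv p t, h) :> ('rV[R]_pp * R^o)%type.
Proof.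
have -> : \sum_i (rep (p i) t - stdp (p i)) *: ((delta_mx 0 i : 'rV[R]_pp), (0 : R^o))
    = (repv p t - stdv p, 0).
  rewrite [in RHS](row_sum_delta (repv p t - stdv p)).
  elim/big_rec2 : _ => // i w1 w2 _ ->; congr (_, _) => /=.
    by rewrite !mxE.
  by rewrite scaler0 addr0.
by congr (_, _) => /=; rewrite ?addr0// addrC subrK.
Qed.

Lemma repv_near (pp : nat) (p : 'I_pp -> FR R) (U : set ('rV[R]_pp * R^o)%type) (x0 : R) :
  open U -> U (stdv p, x0) ->
  exists2 rho : R, 0 < rho & exists2 d : R, 0 < d & forall t h,
    0 <= t -> t < d -> `|h - x0| < rho -> U (repv p t, h).
Proof.
move=> oU Ux.
have cz : {for x0, continuous (fun h : R => (stdv p, h) : ('rV[R]_pp * R^o)%type)}.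
  move=> A [[B C] /= [nB nC] BCA]; apply: filterS nC => h Ch.
  by apply: BCA; split => //; exact: nbhs_singleton.
have [rho rho0 [d d0 H]] := perturbation_near (index_enum 'I_pp)
  (fun i => ((delta_mx 0 i : 'rV[R]_pp), (0 : R^o))) cz
  (fun i => nilpotent0_vanishing (nilpotent0_rep (p i))) (open_nbhs_nbhs (conj oU Ux)).
exists rho => //; exists d => // t h t0 td hr; rewrite -repv_decomp; apply: (H t) => //.
apply: (le_trans (ler_norm_sum _ _ _)); apply: ler_sum => j _.
by rewrite normrZ normr_id.
Qed.

(** [D y] represents the value at [y], [d] the derivative at [x], and [E i j] is the j-th derivative
    of [E i 0]. Only increments of [D] are expanded, because the [E i 0] are antiderivatives, fixed
    up to constants. Working with maps of [t] lets two such data be subtracted. *)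
Definition has_expansion (J : set (FR R)) (D : FR R -> R -> R) (d : R -> R) (x : FR R) :=
  exists2 rho : R, 0 < rho & exists (T : finType) (m : T -> R -> R) (E : T -> nat -> R -> R),
  [/\ forall i, bounded0 (m i),
      forall i j h, `|h - stdp x| < rho -> is_derive h 1 (E i j) (E i j.+1 h),
      forall y y', J y -> J y' -> `|stdp y - stdp x| < rho -> `|stdp y' - stdp x| < rho ->
        little_o_t (fun t => D y t - D y' t -
          \sum_i m i t * (E i 0%N (rep y t) - E i 0%N (rep y' t))) &
      little_o_t (fun t => d t - \sum_i m i t * E i 1%N (rep x t))].

Lemma FRderiv_expansion (J : set (FR R)) (I : FR R -> FR R) (x d : FR R) :
  J x -> FRderiv J I x d -> has_expansion J (fun y => rep (I y)) (rep d) x.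
Proof.
move=> Jx [V [pp [P [p [alpha [[[oV Vx] oP Pp sa Ia] dx]]]]]].
set x0 := stdp x.
pose U := P `*` V.
have oU : open U by exact: openX_prod.
pose z (h : R) : ('rV[R]_pp * R^o)%type := (stdv p, h).
have Uz : U (z x0) by [].
have cz : {for x0, continuous z}.
  move=> A [[B C] /= [nB nC] BCA]; apply: filterS nC => h Ch.
  by apply: BCA; split => //; exact: nbhs_singleton.
pose v (i : 'I_pp) : ('rV[R]_pp * R^o)%type := (delta_mx 0 i, 0).
pose de (i : 'I_pp) (t : R) := rep (p i) t - stdp (p i).
have zE t h : z h + \sum_i de i t *: v i = (repv p t, h) by exact: repv_decomp.
have nde i : nilpotent0 (de i) by exact: nilpotent0_rep.
have sg : smooth_on U (d2 alpha) := 
    @smooth_on_iter_dir R ('rV[R]_pp * R^o)%type U alpha [:: (0, 1)] sa.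
have [T [m [e [bm Ae [r1 r10 Hr1]]]]] := expansion (index_enum 'I_pp) v oU Uz cz nde sg.
have [rho0 /= rho00 Hrho0] : nbhs x0 V by exact: open_nbhs_nbhs.
have inV h : `|h - x0| < rho0 -> V h.
  by move=> hx; apply: Hrho0; rewrite /= distrC.
have [r2 r20 [d1 d10 zzU]] := repv_near oU Uz.
(* Position 0 is an antiderivative of [e i]; the higher ones exist since [e i] is an iterated
   derivative of [d2 alpha] along [z], and [z] moves in the direction (0, 1). *)
have jets i : exists E : nat -> R -> R, (E 1%N =1 e i) /\
    forall j h, `|h - x0| < rho0 / 2 -> is_derive h 1 (E j) (E j.+1 h).
  have [vs evs] := Ae i.
  pose E j h : R := iter_dir (nseq j ((0 : 'rV[R]_pp), (1 : R^o)) ++ vs) (d2 alpha) (z h).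
  have dE j h : `|h - x0| < rho0 -> is_derive h 1 (E j) (E j.+1 h).
    move=> hx; apply: is_derive_snd.
    have Uh : U (stdv p, h) by split => //; exact: inV.
    by have [/(_ (0, 1))] := sg (nseq j (0, 1) ++ vs) _ Uh.
  have [F HF] := @primitive_exists (E 0%N) x0 rho0 rho00
    (fun h hx => is_derive_continuous (dE 0%N h hx)).
  exists (fun j => if j is j'.+1 then E j' else F); split.
    by move=> h; rewrite /E evs.
  move=> [|j] h hx; first exact: HF.
  apply: dE; apply: (lt_trans hx); lra.
have /choice[E HE] := jets.
pose rho := Num.min (rho0 / 2) (Num.min r1 r2).
have rho_gt0 : 0 < rho by rewrite !lt_min divr_gt0// r10.
have hrho h : `|h - x0| < rho -> [/\ `|h - x0| < rho0 / 2, `|h - x0| < r1 & `|h - x0| < r2].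
  by rewrite !lt_min => /and3P[].
have EE i h : E i 1%N h = e i h by have [->] := HE i.
have Jrep y : J y -> `|stdp y - x0| < rho ->
    little_o_t (fun t => rep (I y) t - alpha (repv p t, rep y t)).
  move=> Jy /hrho[y1 _ _].
  have /is_repP[_ /little_oN] : is_rep (I y) (fun t => alpha (repv p t, rep y t)).
    apply: Ia => //; apply: inV; apply: (lt_trans y1); lra.
  by apply: little_o_eq => t; rewrite opprB.
have expd : forall eps, 0 < eps -> exists2 d : R, 0 < d & forall t h, 0 <= t -> t < d ->
    `|h - x0| < rho -> `|d2 alpha (repv p t, h) - \sum_i m i t * E i 1%N h| <= eps * t.
  move=> eps eps0; have [d' d'0 H] := Hr1 eps eps0.
  exists d' => // t h t0 td /hrho[_ h1 _].
  rewrite (eq_bigr (fun i => m i t * e i h)) => [|i _]; last by rewrite EE.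
  by rewrite -zE; exact: H.
exists rho => //; exists T, m, E; split => //.
- by move=> i j h /hrho[hx _ _]; have [_] := HE i; apply.
- move=> y y' Jy Jy' yx y'x.
  suff H : little_o_t (fun t => alpha (repv p t, rep y t) - alpha (repv p t, rep y' t) -
      \sum_i m i t * (E i 0%N (rep y t) - E i 0%N (rep y' t))).
    have := little_oD H (little_oB (Jrep y Jy yx) (Jrep y' Jy' y'x)).
    by apply: little_o_eq => t; ring.
  move=> eps eps0.
  (* Tolerance eps / (2 rho): the mean value bound is multiplied by |y_t - y'_t|, which is at most 2
     rho. *)
  have [d2' d20 H2] := expd _ (divr_gt0 eps0 (mulr_gt0 (ltr0Sn _ 1) rho_gt0)).
  have [d3 d30 H3] := rep_near yx.
  have [d4 d40 H4] := rep_near y'x.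
  exists (Num.min (Num.min d1 d2') (Num.min d3 d4)).
    by rewrite !lt_min d10 d20 d30.
  move=> t t0; rewrite !lt_min => /andP[/andP[t1 t2] /andP[t3 t4]].
  have {}H3 := H3 t t0 t3; have {}H4 := H4 t t0 t4.
  pose G h : R := alpha (repv p t, h) - \sum_i m i t * E i 0%N h.
  pose G' h : R := d2 alpha (repv p t, h) - \sum_i m i t * E i 1%N h.
  have inb h : h \in `[Num.min (rep y' t) (rep y t), Num.max (rep y' t) (rep y t)] ->
      `|h - x0| < rho.
    by move=> hb; exact: between_near hb H4 H3.
  have dG h : h \in `[Num.min (rep y' t) (rep y t), Num.max (rep y' t) (rep y t)] ->
      is_derive h 1 G (G' h).
    move=> /inb hx; have [hx1 hx2 hx3] := hrho _ hx.
    apply: is_deriveB.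
      apply: is_derive_snd.
      by have [/(_ (0, 1))] := sa [::] _ (zzU t h t0 t1 hx3).
    by apply: is_derive_lincomb => i; have [_] := HE i; apply.
  have bG h : h \in `[Num.min (rep y' t) (rep y t), Num.max (rep y' t) (rep y t)] ->
      `|G' h| <= eps / (2 * rho) * t.
    by move=> /inb; exact: H2.
  have -> : alpha (repv p t, rep y t) - alpha (repv p t, rep y' t) -
      \sum_i m i t * (E i 0%N (rep y t) - E i 0%N (rep y' t)) = G (rep y t) - G (rep y' t).
    under eq_bigr do rewrite mulrBr.
    by rewrite sumrB /G; ring.
  apply: (le_trans (mean_value_bound dG bG)).
  have yy' : `|rep y t - rep y' t| <= 2 * rho.
    have -> : rep y t - rep y' t = (rep y t - x0) - (rep y' t - x0) by ring.
    by apply: (le_trans (ler_normB _ _)); lra.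
  have /ler_wpM2l/(_ _ _ yy') : 0 <= eps / (2 * rho) * t.
    by rewrite mulr_ge0// divr_ge0// ?ltW// mulr_gt0.
  move=> /le_trans; apply.
  by rewrite mulrAC divfK ?gt_eqF// mulr_gt0.
- have /is_repP[_ od] := dx.
  have ox : little_o_t (fun t => d2 alpha (repv p t, rep x t) - \sum_i m i t * E i 1%N (rep x t)).
    move=> eps eps0; have [d' d'0 H] := expd _ eps0.
    have [|d'' d''0 H''] := @rep_near x x0 rho; first by rewrite subrr normr0.
    exists (Num.min d' d''); first by rewrite lt_min d'0.
    move=> t t0; rewrite lt_min => /andP[td' td'']; apply: H => //.
    exact: H''.
  by apply: little_o_eq (little_oB ox od) => t; ring.
Qed.

End DerivativeExpansion.

(** * Maps with zero derivative are constant *)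

Section Uniqueness.
Context {R : realType}.
Implicit Types (J : set (FR R)) (S : set R) (D : FR R -> R -> R).

Lemma sum_mulNr (T : finType) (m f : T -> R) :
  \sum_i - m i * f i = - \sum_i m i * f i.
Proof. by rewrite -sumrN; apply: eq_bigr => i _; rewrite mulNr. Qed.

Lemma sum_mulrN (T : finType) (m f : T -> R) :
  \sum_i m i * - f i = - \sum_i m i * f i.
Proof. by rewrite -sumrN; apply: eq_bigr => i _; rewrite mulrN. Qed.

Lemma sum_mulrB (T : finType) (m f g : T -> R) :
  \sum_i m i * (f i - g i) = \sum_i m i * f i - \sum_i m i * g i.
Proof. by rewrite -sumrB; apply: eq_bigr => i _; rewrite mulrBr. Qed.

Lemma sum_mulr0 (T : finType) (m : T -> R) : \sum_i m i * 0 = 0.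
Proof. by rewrite big1// => i _; rewrite mulr0. Qed.

Lemma has_expansionB J D1 D2 d x :
  has_expansion J D1 d x -> has_expansion J D2 d x ->
  has_expansion J (fun y t => D1 y t - D2 y t) (fun=> 0) x.
Proof.
move=> [r1 r10 [T1 [m1 [E1 [bm1 dE1 De1 de1]]]]] [r2 r20 [T2 [m2 [E2 [bm2 dE2 De2 de2]]]]].
exists (Num.min r1 r2); first by rewrite lt_min r10.
exists (T1 + T2)%type,
  (fun i => match i with inl i => m1 i | inr i => (fun t => - m2 i t) end),
  (fun i => match i with inl i => E1 i | inr i => E2 i end); split.
- case=> i //; have := bounded0M (@bounded0_cst _ (-1)) (bm2 i).
  by congr bounded0; apply/funext => t; rewrite mulN1r.
- by move=> [i|i] j h; rewrite lt_min => /andP[]; [move=> + _; exact: dE1|move=> _; exact: dE2].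
- move=> y y' Jy Jy'; rewrite !lt_min => /andP[y1 y2] /andP[y'1 y'2].
  apply: little_o_eq (little_oB (De1 y y' Jy Jy' y1 y'1) (De2 y y' Jy Jy' y2 y'2)) => t.
  rewrite big_sumType /=.
  by rewrite sum_mulNr; ring.
- apply: little_o_eq (little_oB de1 de2) => t.
  rewrite big_sumType /=.
  by rewrite sum_mulNr; ring.
Qed.

(* [S] is the interior of the set of standard parts of the points of [J]. *)
Definition interval_core J S := [/\
  forall r, S r -> J (cstFR r),
  forall r, S r -> exists2 eta : R, 0 < eta & forall h, `|h - r| < eta -> S h,
  forall y y' r, J y -> J y' -> stdp y < r < stdp y' -> S r &
  forall y e, J y -> 0 < e -> exists2 r, S r & `|r - stdp y| < e].

(** [F N] is bounded near the standard part by continuity, and the N-th power of the nilpotent part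
    is o(t), so the Taylor remainder is negligible. *)
Lemma jet_taylor (F : nat -> R -> R) (Y : FR R) (a rho : R) N :
  `|stdp Y - a| < rho ->
  (forall j h, `|h - a| < rho -> is_derive h 1 (F j) (F j.+1 h)) ->
  little_o_t (fun t => (rep Y t - stdp Y) ^+ N) ->
  little_o_t (fun t => F 0%N (rep Y t) - taylor F N (stdp Y) (rep Y t)).
Proof.
move=> Ya dF oN.
have cF : {for stdp Y, continuous (F N)} := is_derive_continuous (dF N _ Ya).
have nF : nbhs (stdp Y) [set h | `|F N h| <= `|F N (stdp Y)| + 1].
  apply: (cF [set y : R | `|y| <= `|F N (stdp Y)| + 1]).
  exists 1 => //= y yB; have {}yB : `|F N (stdp Y) - y| < 1 by [].
  have := ler_normD (F N (stdp Y)) (y - F N (stdp Y)); rewrite addrC subrK => /le_trans; apply.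
  by rewrite lerD2l distrC ltW.
have [r /= r0 Hr] := nF.
(* Radius [r] keeps [F N] bounded; the other term keeps the segment inside the domain of the jet. *)
have rr0 : 0 < Num.min r (rho - `|stdp Y - a|) by rewrite lt_min r0 subr_gt0.
have [|d d0 Hd] := @rep_near R Y (stdp Y) (Num.min r (rho - `|stdp Y - a|)).
  by rewrite subrr normr0.
apply: little_o_dom oN; exists (`|F N (stdp Y)| + 1), d => // t t0 td.
have inb h : h \in `[Num.min (stdp Y) (rep Y t), Num.max (stdp Y) (rep Y t)] ->
    `|h - stdp Y| < r /\ `|h - a| < rho.
  move=> hb; have := @between_near R _ _ (stdp Y) (Num.min r (rho - `|stdp Y - a|)) _ hb.
  rewrite subrr normr0 => /(_ rr0 (Hd t t0 td)); rewrite lt_min => /andP[h1 h2]; split => //.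
  have -> : h - a = (h - stdp Y) + (stdp Y - a) by rewrite addrA subrK.
  by apply: (le_lt_trans (ler_normD _ _)); rewrite -ltrBrDr.
have H1 k h : (k < N)%N -> h \in `[Num.min (stdp Y) (rep Y t), Num.max (stdp Y) (rep Y t)] ->
    is_derive h 1 (F k) (F k.+1 h).
  by move=> _ /inb[_ ha]; exact: dF.
have H2 h : h \in `[Num.min (stdp Y) (rep Y t), Num.max (stdp Y) (rep Y t)] ->
    `|F N h| <= `|F N (stdp Y)| + 1.
  by move=> /inb[hr _]; apply: Hr; rewrite /= distrC.
by rewrite normrX; exact: (taylor_bound H1 H2).
Qed.

(** The chosen representative of a constant equals it only modulo o(t); Taylor's formula with one
    term lets it be replaced inside [F]. *)
Lemma jet_cstFR (F : nat -> R -> R) (h a rho : R) :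
  `|h - a| < rho ->
  (forall j h, `|h - a| < rho -> is_derive h 1 (F j) (F j.+1 h)) ->
  little_o_t (fun t => F 0%N (rep (cstFR h) t) - F 0%N h).
Proof.
move=> ha dF; have := @jet_taylor F (cstFR h) a rho 1; rewrite stdp_cstFR => /(_ ha dF).
have oh : little_o_t (fun t => (rep (cstFR h) t - h) ^+ 1) by exact: rep_cstFR.
move=> /(_ oh); apply: little_o_eq => t.
by rewrite /taylor big_ord1 expr0 fact0 mulr1 divr1.
Qed.

Lemma little_o_jet_sum (T : finType) (m : T -> R -> R) (f g : T -> R -> R) :
  (forall i, bounded0 (m i)) -> (forall i, little_o_t (fun t => f i t - g i t)) ->
  little_o_t (fun t => \sum_i m i t * f i t - \sum_i m i t * g i t).
Proof.
move=> bm fg; have := @little_o_sum R T (index_enum T) xpredT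
  (fun i t => m i t * (f i t - g i t)) (fun i _ => little_oM (bm i) (fg i)).
apply: little_o_eq => t; rewrite -sumrB.
by apply: eq_bigr => i _; rewrite mulrBr.
Qed.

Section LocallyConstant.
Variables (J : set (FR R)) (S : set R) (D : FR R -> R -> R).
Hypothesis JS : interval_core J S.
Hypothesis De : forall x, J x -> has_expansion J D (fun=> 0) x.

Section StandardPoints.
Variables (x : FR R) (rho : R) (T : finType) (m : T -> R -> R) (E : T -> nat -> R -> R).
Hypothesis bm : forall i, bounded0 (m i).
Hypothesis dE : forall i j h, `|h - stdp x| < rho -> is_derive h 1 (E i j) (E i j.+1 h).
Hypothesis DE : forall y y', J y -> J y' -> `|stdp y - stdp x| < rho ->
  `|stdp y' - stdp x| < rho ->
  little_o_t (fun t => D y t - D y' t -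
          \sum_i m i t * (E i 0%N (rep y t) - E i 0%N (rep y' t))).

(** At standard points the coefficients no longer depend on [t], which is the form the closure
    lemmas require. *)
Lemma expansion_std h h' : S h -> S h' -> `|h - stdp x| < rho -> `|h' - stdp x| < rho ->
  little_o_t (fun t => D (cstFR h) t - D (cstFR h') t -
    \sum_i m i t * (E i 0%N h - E i 0%N h')).
Proof.
have [SJ _ _ _] := JS => Sh Sh' hx h'x.
have := @DE (cstFR h) (cstFR h') (SJ _ Sh) (SJ _ Sh'); rewrite !stdp_cstFR => /(_ hx h'x) o1.
have o2 := little_o_jet_sum bm (fun i => jet_cstFR hx (dE i)).
have o3 := little_o_jet_sum bm (fun i => jet_cstFR h'x (dE i)).
have := little_oD o1 (little_oB o2 o3); apply: little_o_eq => t.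
by rewrite !sum_mulrB; ring.
Qed.

End StandardPoints.

Section ConstantNear.
Variables (x : FR R) (rho : R) (T : finType) (m : T -> R -> R) (E : T -> nat -> R -> R).
Hypothesis bm : forall i, bounded0 (m i).
Hypothesis dE : forall i j h, `|h - stdp x| < rho -> is_derive h 1 (E i j) (E i j.+1 h).
Hypothesis DE : forall y y', J y -> J y' -> `|stdp y - stdp x| < rho ->
  `|stdp y' - stdp x| < rho ->
  little_o_t (fun t => D y t - D y' t -
          \sum_i m i t * (E i 0%N (rep y t) - E i 0%N (rep y' t))).

Lemma near_core r : S r -> `|r - stdp x| < rho ->
  exists2 eta : R, 0 < eta & forall h, `|h - r| < eta -> S h /\ `|h - stdp x| < rho.
Proof.
have [_ So _ _] := JS => Sr rx; have [eta eta0 H] := So r Sr.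
exists (Num.min eta (rho - `|r - stdp x|)); first by rewrite lt_min eta0 subr_gt0.
move=> h; rewrite lt_min => /andP[h1 h2]; split; first exact: H.
have -> : h - stdp x = (h - r) + (r - stdp x) by rewrite addrA subrK.
by apply: (le_lt_trans (ler_normD _ _)); rewrite -ltrBrDr.
Qed.

(** The increments of [D] near [r] have two expansions, one around [x] and one around the constant
    [r]. Their difference is a relation at all standard h near [r]; differentiating it at [r]
    equates the two first-order sums modulo o(t), and the second is o(t) because the derivative at
    the constant [r] is zero. Only here does the vanishing derivative enter. *)
Lemma jet1_little_o r : S r -> `|r - stdp x| < rho ->
  little_o_t (fun t => \sum_i m i t * E i 1%N r).
Proof.
have [SJ _ _ _] := JS => Sr rx.
have [rho' rho'0 [T' [n [B [bn dB DB dn]]]]] := De (SJ r Sr).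
have [eta eta0 Heta] := near_core Sr rx.
have rr : `|r - stdp (cstFR r)| < rho' by rewrite stdp_cstFR subrr normr0.
pose mn (i : T + T') := match i with inl i => m i | inr i => n i end.
pose c (i : T + T') h := match i with inl i => E i 0%N h - E i 0%N r
  | inr i => - (B i 0%N h - B i 0%N r) end.
pose v (i : T + T') := match i with inl i => E i 1%N r - 0 | inr i => - (B i 1%N r - 0) end.
have dc i : is_derive r 1 (c i) (v i).
  case: i => i; rewrite /c /v.
    by apply: is_deriveB; exact: dE.
  by apply: is_deriveN; apply: is_deriveB; exact: dB.
have e0 : 0 < Num.min eta rho' by rewrite lt_min eta0.
have Hc h : `|h - r| < Num.min eta rho' -> little_o_t (fun t => \sum_i mn i t * c i h).
  rewrite lt_min => /andP[/Heta[Sh hx] hr].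
  have hr' : `|h - stdp (cstFR r)| < rho' by rewrite stdp_cstFR.
  have := little_oB (expansion_std bn dB DB Sh Sr hr' rr) (expansion_std bm dE DE Sh Sr hx rx).
  apply: little_o_eq => t; rewrite big_sumType /=.
  by rewrite sum_mulrN; ring.
have o1 := little_o_closure_derive e0 dc Hc.
(* The hypothesis [dn] is stated at the representative of the constant; this moves it to [r] itself,
   with the jet shifted by one. *)
have o2 := little_o_jet_sum bn (fun i => @jet_cstFR (fun j => B i j.+1) _ _ _ rr
  (fun j h => dB i j.+1 h)).
have := little_oB (little_oB o1 o2) dn; apply: little_o_eq => t.
rewrite big_sumType /=.
by rewrite sum_mulrN !sum_mulrB !sum_mulr0; ring.
Qed.

Lemma jetS_little_o j r : S r -> `|r - stdp x| < rho ->
  little_o_t (fun t => \sum_i m i t * E i j.+1 r).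
Proof.
elim: j r => [|j IHj] r Sr rx; first exact: jet1_little_o.
have [eta eta0 Heta] := near_core Sr rx.
apply: (little_o_closure_derive (c := fun i => E i j.+1) eta0) => [i|h /Heta[]].
  exact: dE.
exact: IHj.
Qed.

(** The standard part of [y] may be an end of [S]; it is a limit of points of [S], and the relation
    passes to the limit. *)
Lemma jetS_std_little_o j y : J y -> `|stdp y - stdp x| < rho ->
  little_o_t (fun t => \sum_i m i t * E i j.+1 (stdp y)).
Proof.
have [_ _ _ Sc] := JS => Jy yx.
apply: (@little_o_closure_continuous R T m (fun i => E i j.+1)
  [set r | S r /\ `|r - stdp x| < rho]).
- move=> A /nbhs_ballP[e /= e0 He].
  have e'0 : 0 < Num.min e (rho - `|stdp y - stdp x|) by rewrite lt_min e0 subr_gt0.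
  have [r Sr] := Sc y _ Jy e'0; rewrite lt_min => /andP[re rr].
  exists r; split; last by apply: He; rewrite -ball_normE /= distrC.
  split=> //; have -> : r - stdp x = (r - stdp y) + (stdp y - stdp x) by rewrite addrA subrK.
  by apply: (le_lt_trans (ler_normD _ _)); rewrite -ltrBrDr.
- by move=> i; exact: is_derive_continuous (dE i j.+1 yx).
- by move=> h [Sh hx]; exact: jetS_little_o.
Qed.

(** Integrates the first-order relation between the two standard parts, the open interval between
    them lying in [S]. *)
Lemma jet0_std_little_o y y' : J y -> J y' -> `|stdp y - stdp x| < rho ->
  `|stdp y' - stdp x| < rho ->
  little_o_t (fun t => \sum_i m i t * (E i 0%N (stdp y) - E i 0%N (stdp y'))).
Proof.
have [_ _ Sb _] := JS.
wlog yy' : y y' / stdp y' < stdp y.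
  move=> H Jy Jy' yx y'x; have [lt|lt|->] := ltgtP (stdp y') (stdp y).
  - exact: H.
  - have := little_oN (H y' y lt Jy' Jy y'x yx); apply: little_o_eq => t.
    by rewrite !sum_mulrB opprB.
  - by apply: little_o_eq (@little_o0 R) => t; rewrite big1// => i _; rewrite subrr mulr0.
move=> Jy Jy' yx y'x.
have bt h : stdp y' <= h <= stdp y -> `|h - stdp x| < rho.
  move=> hb; apply: between_near y'x yx.
  by rewrite in_itv /= (min_idPl (ltW yy')) (max_idPr (ltW yy')).
apply: (@little_o_closure_increment R T m (fun i => E i 0%N) (fun i => E i 1%N)) => //.
- by move=> i h /bt; exact: dE.
- move=> h hb; apply: jetS_little_o; first exact: Sb hb.
  by apply: bt; move: hb => /andP[? ?]; rewrite !ltW.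
Qed.

(** In the Taylor expansion at the standard part, every term of order at least 1 is a bounded map
    times a sum already known to be o(t). *)
Lemma jet0_rep_little_o y : J y -> `|stdp y - stdp x| < rho ->
  little_o_t (fun t => \sum_i m i t * E i 0%N (rep y t) - \sum_i m i t * E i 0%N (stdp y)).
Proof.
move=> Jy yx; have [N oN] := nilpotent0_rep y.
(* With N+1 Taylor terms, the value at the standard part splits off and exactly [N] higher terms
   remain. *)
have {}oN := little_o_expr_ge (leqnSn N) oN.
have o1 := little_o_jet_sum bm (fun i => jet_taylor yx (dE i) oN).
have o2 : little_o_t (fun t => \sum_(k < N) ((rep y t - stdp y) ^+ k.+1 / k.+1`!%:R) *
    \sum_i m i t * E i k.+1 (stdp y)).
  apply: little_o_sum => k _; apply: little_oM; last exact: jetS_std_little_o.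
  apply: bounded0M; last exact: bounded0_cst.
  exact/bounded0X/vanishing_bounded0/nilpotent0_vanishing/nilpotent0_rep.
have := little_oD o1 o2; apply: little_o_eq => t.
have -> : \sum_i m i t * taylor (E i) N.+1 (stdp y) (rep y t) =
    \sum_i m i t * E i 0%N (stdp y) + \sum_(k < N) ((rep y t - stdp y) ^+ k.+1 / k.+1`!%:R) *
    \sum_i m i t * E i k.+1 (stdp y).
  under [X in _ = _ + X]eq_bigr do rewrite mulr_sumr.
  rewrite exchange_big -big_split /=; apply: eq_bigr => i _.
  rewrite /taylor big_ord_recl expr0 fact0 mulr1 divr1 mulrDr mulr_sumr.
  by congr (_ + _); apply: eq_bigr => k _; rewrite /bump /= ?add1n; ring.
by ring.
Qed.

(** The increment from [y'] to [y] is split by passing through the two standard parts. *)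
Lemma constant_near y y' : J y -> J y' -> `|stdp y - stdp x| < rho ->
  `|stdp y' - stdp x| < rho -> little_o_t (fun t => D y t - D y' t).
Proof.
move=> Jy Jy' yx y'x.
have := little_oD (DE Jy Jy' yx y'x)
  (little_oD (little_oB (jet0_rep_little_o Jy yx) (jet0_rep_little_o Jy' y'x))
     (jet0_std_little_o Jy Jy' yx y'x)).
apply: little_o_eq => t.
by rewrite !sum_mulrB; ring.
Qed.

End ConstantNear.

Lemma locally_constant x : J x -> exists2 rho : R, 0 < rho & forall y y', J y -> J y' ->
  `|stdp y - stdp x| < rho -> `|stdp y' - stdp x| < rho ->
  little_o_t (fun t => D y t - D y' t).
Proof.
move=> Jx; have [rho rho0 [T [m [E [bm dE DE _]]]]] := De Jx.
by exists rho => // y y'; exact: (constant_near bm dE DE).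
Qed.

(** A supremum argument on real standard parts, since local constancy holds over neighbourhoods of
    standard parts. *)
Lemma expansion0_constant y y' : J y -> J y' -> little_o_t (fun t => D y t - D y' t).
Proof.
have [SJ _ Sb _] := JS.
wlog yy' : y y' / stdp y <= stdp y'.
  move=> H Jy Jy'; have [le|/ltW le] := leP (stdp y) (stdp y'); first exact: H.
  by apply: little_o_eq (little_oN (H y' y le Jy' Jy)) => t; rewrite opprB.
move=> Jy Jy'.
(* All points over [r] are treated together, as infinitely close points share a standard part. *)
pose A r := forall w, J w -> stdp w = r -> little_o_t (fun t => D w t - D y t).
have lift r : stdp y <= r <= stdp y' -> exists2 w, J w & stdp w = r.
  rewrite !le_eqVlt => /andP[/predU1P[<-|yr]]; first by exists y.
  move=> /predU1P[->|ry']; first by exists y'.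
  exists (cstFR r); last exact: stdp_cstFR.
  by apply/SJ/(Sb y y') => //; rewrite yr.
have spread r : stdp y <= r <= stdp y' -> exists2 rho : R, 0 < rho & forall a b,
    stdp y <= a <= stdp y' -> `|a - r| < rho -> A a -> `|b - r| < rho -> A b.
  move=> /lift[w Jw <-]; have [rho rho0 H] := locally_constant Jw.
  exists rho => // a b /lift[wa Jwa <-] ar Aa br wb Jwb wbb; rewrite -wbb in br.
  have := little_oD (H wb wa Jwb Jwa br ar) (Aa wa Jwa erefl).
  by apply: little_o_eq => t; rewrite addrA subrK.
have Ay : A (stdp y).
  move=> w Jw wy; have [rho rho0 H] := locally_constant Jy.
  by apply: H => //; rewrite ?wy subrr normr0.
pose B := [set r | stdp y <= r <= stdp y' /\ A r].
have B0 : B !=set0 by exists (stdp y); split => //; rewrite lexx.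
have Bub : has_ubound B by exists (stdp y') => r [/andP[]].
have supB : has_sup B by [].
set s := sup B.
have ys : stdp y <= s by apply: ub_le_sup => //; split => //; rewrite lexx.
have sy' : s <= stdp y' by apply: ge_sup => // r [/andP[]].
have [rho rho0 H] := spread s (introT andP (conj ys sy')).
have [a [ayy' Aa] sa] := sup_adherent rho0 supB.
have as_ : a <= s by apply: ub_le_sup.
have asr : `|a - s| < rho by rewrite ler0_norm ?subr_le0// opprB ltrBlDr addrC -ltrBlDr.
have As b : `|b - s| < rho -> A b := H a b ayy' asr Aa.
have sE : s = stdp y'.
  apply/eqP; rewrite eq_le sy' /= leNgt; apply/negP => lt.
  pose b := Num.min (stdp y') (s + rho / 2).
  have sb : s < b by rewrite lt_min lt/= ltrDl divr_gt0.
  have Bb : B b.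
    split; first by rewrite ge_min lexx/= (le_trans ys)// ltW.
    apply: As; rewrite gtr0_norm ?subr_gt0// ltrBlDr.
    by rewrite (@le_lt_trans _ _ (s + rho / 2))// ?ge_min ?lexx ?orbT//; lra.
  by have := ub_le_sup Bub Bb; rewrite leNgt sb.
have Ay' : A (stdp y') by rewrite -sE; apply: As; rewrite subrr normr0.
by have := little_oN (Ay' y' Jy' erefl); apply: little_o_eq => t; rewrite opprB.
Qed.

End LocallyConstant.

End Uniqueness.

(** * Translates of primitives *)

Section SmoothOperations.
Context {R : realType}.

(** For linear [pi], the difference quotients of [g \o pi] along [v] are literally those of [g]
    along [pi v]. *)
Lemma growth_rate_comp (V W : normedModType R) (pi : V -> W) (g : W -> R^o) (x v : V) :
  (forall a x y, pi (a *: x + y) = a *: pi x + pi y) ->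
  (fun h : R => h^-1 *: (((g \o pi) \o shift x) (h *: v) - (g \o pi) x)) =
  (fun h : R => h^-1 *: ((g \o shift (pi x)) (h *: pi v) - g (pi x))).
Proof. by move=> piD; apply/funext => h /=; rewrite piD. Qed.

Lemma iter_dir_comp (V W : normedModType R) (pi : V -> W) (g : W -> R^o) vs :
  (forall a x y, pi (a *: x + y) = a *: pi x + pi y) ->
  iter_dir vs (g \o pi) = iter_dir [seq pi v | v <- vs] g \o pi.
Proof.
move=> piD; elim: vs => //= v vs ->; apply/funext => x /=.
by rewrite /derive growth_rate_comp.
Qed.

Lemma smooth_on_comp (V W : normedModType R) (pi : V -> W) (g : W -> R^o) (U : set W) :
  (forall a x y, pi (a *: x + y) = a *: pi x + pi y) -> continuous pi ->
  smooth_on U g -> smooth_on (pi @^-1` U) (g \o pi).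
Proof.
move=> piD cpi sg vs x Ux; rewrite iter_dir_comp//.
have [dg cg] := sg [seq pi v | v <- vs] _ Ux; split=> [v|].
  by rewrite /derivable (growth_rate_comp _ _ _ piD); exact: dg.
by apply: continuous_comp; [exact: cpi|exact: cg].
Qed.

Lemma iter_dirB (V : normedModType R) (f g : V -> R^o) (U : set V) vs : open U ->
  smooth_on U f -> smooth_on U g ->
  forall x, U x -> iter_dir vs (fun x => f x - g x) x = iter_dir vs f x - iter_dir vs g x.
Proof.
move=> oU sf sg; elim: vs => //= v vs IHvs x Ux.
have [[df _] [dg _]] := (sf vs x Ux, sg vs x Ux).
rewrite -(deriveB (df v) (dg v)); apply: near_eq_derive.
by near=> y; apply: IHvs; near: y; exact: open_nbhs_nbhs.
Unshelve. all: by end_near. Qed.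

Lemma smooth_onB (V : normedModType R) (f g : V -> R^o) (U : set V) : open U ->
  smooth_on U f -> smooth_on U g -> smooth_on U (fun x => f x - g x).
Proof.
move=> oU sf sg vs x Ux.
have [[df cf] [dg cg]] := (sf vs x Ux, sg vs x Ux).
have E : {near x, iter_dir vs f \- iter_dir vs g =1 iter_dir vs (fun x => f x - g x)}.
  near=> y; apply/esym/(iter_dirB vs oU sf sg).
  by near: y; exact: open_nbhs_nbhs.
split=> [v|].
  apply: near_eq_derivable E _.
  by apply: derivableB; [exact: df|exact: dg].
rewrite /prop_for /continuous_at -(nbhs_singleton E).
apply: cvg_trans (continuousB cf cg).
by apply: near_eq_cvg.
Unshelve. all: by end_near. Qed.

Lemma smooth_on_id (U : set R^o) : smooth_on U (fun x : R^o => x).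
Proof.
have Dcst (vs : seq R^o) (c : R) : iter_dir vs (fun _ : R^o => c : R^o) = (fun _ => if vs is [::] then c else 0).
  by case: vs => // v vs; elim: vs v => [|w vs IHvs] v /=;
    [|have /= -> := IHvs w]; apply/funext => x; exact: derive_cst.
have Did (vs : seq R^o) : iter_dir vs (fun x : R^o => x) = (fun x => x) \/
    exists c : R, iter_dir vs (fun x : R^o => x) = (fun _ => c).
  elim: vs => [|v vs [IHvs|[c IHvs]]] /=; [by left| |]; right; rewrite IHvs.
    by exists v; apply/funext => x; exact: derive_id.
  by exists 0; apply/funext => x; exact: derive_cst.
move=> vs x _; have [->|[c ->]] := Did vs.
  by split => [v|]; [exact: derivable_id|exact: cvg_id].
by split => [v|]; [exact: derivable_cst|exact: cvg_cst].
Qed.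

End SmoothOperations.

(** * Subtracting a constant from a local representation *)

Section Translation.
Context {R : realType} (pp : nat).

Definition tail_row (z : ('rV[R]_pp.+1 * R^o)%type) : ('rV[R]_pp * R^o)%type :=
  (\row_i z.1 0 (lift ord0 i), z.2).

Definition head_row (z : ('rV[R]_pp.+1 * R^o)%type) : R^o := z.1 0 ord0.

Lemma tail_rowP a x y : tail_row (a *: x + y) = a *: tail_row x + tail_row y.
Proof. by congr (_, _); apply/rowP => i; rewrite !mxE. Qed.

Lemma head_rowP a x y : head_row (a *: x + y) = a *: head_row x + head_row y.
Proof. by rewrite /head_row /= !mxE. Qed.

Lemma head_row_continuous : continuous head_row.
Proof.
move=> z; apply: (@continuous_comp _ _ _ fst (fun q : 'rV[R]_pp.+1 => q 0 ord0)).
  exact: cvg_fst.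
exact: coord_continuous.
Qed.

Lemma tail_row_continuous : continuous tail_row.
Proof.
move=> [q h] A /nbhs_ballP[e /= e0 He]; apply/nbhs_ballP; exists e => //= -[q' h'] [/= qq' hh'].
apply: He; split => //=; split=> // i j; rewrite !mxE.
by have [_] := qq'.
Qed.

(** The constant [c] may be nonstandard, so it cannot be absorbed into [alpha]; it becomes
    coordinate 0 of the parameter, and that coordinate is subtracted. The derivative in the last
    variable is unaffected. *)
Lemma local_rep_translate (J : set (FR R)) (I : FR R -> FR R) x V P (p : 'I_pp -> FR R)
    alpha (c : FR R) :
  local_rep J I x V P p alpha ->
  exists (P' : set 'rV[R]_pp.+1) (p' : 'I_pp.+1 -> FR R) alpha',
    local_rep J (fun y => I y - c) x V P' p' alpha' /\
    forall d, J x -> is_rep d (fun t => d2 alpha (repv p t, rep x t)) ->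
      is_rep d (fun t => d2 alpha' (repv p' t, rep x t)).
Proof.
move=> [[oV Vx] oP Pp sa Ia].
pose p' (i : 'I_pp.+1) := if unlift ord0 i is Some j then p j else c.
have tailE t (h : R) : tail_row (repv p' t, h) = (repv p t, h).
  by congr (_, _); apply/rowP => i; rewrite !mxE /p' liftK.
have tail_std (h : R) : tail_row (stdv p', h) = (stdv p, h).
  by congr (_, _); apply/rowP => i; rewrite !mxE /p' liftK.
pose alpha' z := alpha (tail_row z) - head_row z.
pose proj (q : 'rV[R]_pp.+1) : 'rV[R]_pp := \row_i q 0 (lift ord0 i).
have cproj : continuous proj.
  move=> q A /nbhs_ballP[e /= e0 He]; apply/nbhs_ballP; exists e => //= q' qq'.
  by apply: He; split=> // i j; rewrite !mxE; have [_] := qq'.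
pose P' := proj @^-1` P.
have oP' : open P' by exact: (open_comp (fun x _ => cproj x)).
have UE : P' `*` V = tail_row @^-1` (P `*` V) by [].
have oU : open (P' `*` V) by exact: openX_prod.
have s1 : smooth_on (P' `*` V) (alpha \o tail_row).
  by rewrite UE; exact: (smooth_on_comp tail_rowP tail_row_continuous sa).
have s2 : smooth_on (P' `*` V) head_row.
  have := smooth_on_comp head_rowP head_row_continuous (@smooth_on_id R setT).
  by move=> H vs z _; exact: (H vs z).
have P'p' : P' (stdv p').
  by rewrite /P' /= (_ : proj _ = stdv p)//; apply/rowP => i; rewrite !mxE /p' liftK.
exists P', p', alpha'; split.
  split => //; first exact: (smooth_onB oU s1 s2).
  move=> y Jy Vy; have /is_repP[Ro1 o1] := Ia y Jy Vy.
  have E : (fun t => alpha' (repv p' t, rep y t)) = (fun t => alpha (repv p t, rep y t) - rep c t).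
    by apply/funext => t; rewrite /alpha' tailE /head_row /= mxE /p' unlift_none.
  rewrite E; apply/is_repP; split; first by apply: RoB => //; exact: Ro_rep.
  have := little_oB o1 (rep_subFR (I y) c).
  by apply: little_o_eq => t; ring.
move=> d Jx /is_repP[Rd od]; have Ux : (P' `*` V) (stdv p', stdp x) by [].
have [rho rho0 [e1 e10 H]] := repv_near oU Ux.
have [|e2 e20 H2] := @rep_near R x (stdp x) rho; first by rewrite subrr normr0.
(* The two derivatives are compared for small [t], once parameter and point have entered the domain
   of smoothness. *)
have o : little_o_t (fun t => d2 alpha' (repv p' t, rep x t) - d2 alpha (repv p t, rep x t)).
  apply: little_o_near (@little_o0 R); exists (Num.min e1 e2); first by rewrite lt_min e10.
  move=> t t0; rewrite lt_min => /andP[t1 t2]; apply/eqP; rewrite subr_eq0; apply/eqP.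
  have Ut := H t _ t0 t1 (H2 t t0 t2).
  pose e : ('rV[R]_pp.+1 * R^o)%type := (0, 1).
  have := iter_dirB [:: e] oU s1 s2 Ut.
  rewrite (iter_dir_comp _ _ tail_rowP) /= /d2 => ->; rewrite /e.
  have -> : tail_row (0, 1) = (0, 1).
    by congr (_, _); apply/rowP => i; rewrite !mxE.
  rewrite tailE (_ : 'D_(0, 1) head_row _ = 0) ?subr0//.
  have := iter_dir_comp (fun x : R^o => x) [:: e] head_rowP.
  move=> /(congr1 (fun f => f (repv p' t, rep x t))) /= ->.
  by rewrite (_ : head_row e = 0) ?derive0// /head_row /= mxE.
apply/is_repP; split.
  have -> : (fun t => d2 alpha' (repv p' t, rep x t)) = (fun t =>
      (d2 alpha' (repv p' t, rep x t) - d2 alpha (repv p t, rep x t)) + d2 alpha (repv p t, rep x t)).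
    by apply/funext => t; rewrite subrK.
  by apply: RoD => //; exact: Ro_little_o.
by have := little_oD o od; apply: little_o_eq => t; rewrite addrA subrK.
Qed.

End Translation.

(** Existence of a primitive thus does not depend on the base point, so the default value of [FRint]
    occurs for all lower limits in [J] or for none. *)
Lemma is_primitive_translate (R : realType) (J : set (FR R)) f u I a :
  J a -> is_primitive J f u I -> is_primitive J f a (fun y => I y - I a).
Proof.
move=> Ja [sI _ dI]; split.
- move=> x /sI[V [pp [P [p [alpha /(local_rep_translate (I a))[P' [p' [al' [H _]]]]]]]]].
  by exists V, pp.+1, P', p', al'.
- exact: subrr.
- move=> x Jx; have [V [pp [P [p [alpha [lr dx]]]]]] := dI x Jx.
  have [P' [p' [al' [H Hd]]]] := local_rep_translate (I a) lr.
  by exists V, pp.+1, P', p', al'; split => //; exact: Hd.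
Qed.

(** * Additivity of the integral *)

Section Increments.
Context {d : Order.disp_t} {T : orderType d} {G : zmodType}.
Local Open Scope order_scope.

(** Telescoping, but indexed by all gaps of [s] under a condition: the index set is then common to
    all pairs and sums can be exchanged. *)
Lemma increment_sum (F : T -> G) (x0 : T) (s : seq T) (a b : T) : sorted <%O s ->
  a \in s -> b \in s -> a <= b ->
  (F b - F a = \sum_(k < (size s).-1 | (a <= nth x0 s k)%O && (nth x0 s k.+1 <= b)%O)
     (F (nth x0 s k.+1) - F (nth x0 s k)))%R.
Proof.
move=> ss; case/(nthP x0) => i il <-; case/(nthP x0) => j jl <-.
have mono := lt_sorted_leq_nth x0 ss.
rewrite mono // => ij.
rewrite -(telescope_sumr (fun k => F (nth x0 s k)) ij).
have jl' : (j <= (size s).-1)%N by rewrite -ltnS prednK// (leq_trans _ jl).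
rewrite [RHS](eq_bigl (fun k : 'I_(size s).-1 => (i <= k)%N && (k < j)%N)); last first.
  move=> k; have kl : (k.+1 < size s)%N.
    by rewrite -ltn_predRL ltn_ord.
  by rewrite !mono ?inE// ltnW.
rewrite (big_nat_widenl i 0%N)// (big_nat_widen 0%N j (size s).-1)// big_mkord.
by apply: eq_bigl.
Qed.

(** No element of [s] lies strictly inside a gap, so a gap is contained in [a i, b i] exactly when
    its midpoint is in [M i], whichever endpoints [M i] contains. Disjointness allows at most one
    such [i], so each gap is counted at most once. *)
Lemma sum_disjoint_increments (F : T -> G) (mid : T -> T -> T) (x0 : T) (s : seq T)
    n (a b : 'I_n -> T) (M : 'I_n -> set T) :
  (forall x y, x < y -> x < mid x y < y) -> sorted <%O s ->
  (forall i, a i \in s) -> (forall i, b i \in s) -> (forall i, a i <= b i) ->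
  (forall i x, a i < x < b i -> M i x) -> (forall i x, M i x -> a i <= x <= b i) ->
  (forall i i', i != i' -> M i `&` M i' = set0) ->
  (\sum_i (F (b i) - F (a i)) = \sum_(k < (size s).-1)
    if `[< (\bigcup_(i in [set: 'I_n]) M i) (mid (nth x0 s k) (nth x0 s k.+1)) >]
    then F (nth x0 s k.+1) - F (nth x0 s k) else 0)%R.
Proof.
move=> midP ss sa sb ab abM Mab Mdisj.
under eq_bigr do rewrite (increment_sum F x0 ss (sa _) (sb _) (ab _)).
rewrite (exchange_big_dep xpredT)//=; apply: eq_bigr => k _.
set e := nth x0 s k; set e' := nth x0 s k.+1; set m := mid e e'.
have kl : (k.+1 < size s)%N.
  by rewrite -ltn_predRL ltn_ord.
have mono := lt_sorted_leq_nth x0 ss.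
have monolt := lt_sorted_ltn_nth x0 ss.
have ee' : e < e' by rewrite monolt ?inE// ltnW.
have /andP[em me'] := midP _ _ ee'.
have low c : c \in s -> c <= m -> c <= e.
  case/(nthP x0) => i il <- /le_lt_trans/(_ me').
  by rewrite monolt ?inE// ltnS => ik; rewrite mono ?inE// ltnW.
have high c : c \in s -> m <= c -> e' <= c.
  case/(nthP x0) => i il <- /(lt_le_trans em).
  by rewrite monolt ?inE ?(ltnW kl)// => ik; rewrite mono ?inE.
have condE i : (a i <= e) && (e' <= b i) = `[< M i m >].
  apply/andP/asboolP => [[ae eb]|Mi].
    by apply: abM; rewrite (le_lt_trans ae em) (lt_le_trans me' eb).
  have /andP[am mb] := Mab _ _ Mi.
  by split; [exact: low|exact: high].
under eq_bigl do rewrite condE.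
case: ifP => [/asboolP[i _ Mi]|/asboolP nM].
  rewrite (big_pred1 i)// => i'; apply/asboolP/eqP => [Mi'|-> //].
  apply/eqP/negPn/negP => /Mdisj; rewrite -subset0 => /(_ m); apply.
  by split.
by rewrite big1// => i /asboolP Mi; exfalso; apply: nM; exists i.
Qed.

End Increments.

(** * From primitives to sums over intervals *)

Section Integral.
Context {R : realType}.
Implicit Types (J I : FRinterval R) (f : FR R -> FR R).

(** A point whose standard part is strictly between those of the ends lies in [J] whatever the
    brackets; [noninf] lets each end be approached from inside. *)
Lemma noninf_interval_core J : noninf J ->
  interval_core (imem J) [set r | (stdE (ilo J) < r%:E < stdE (ihi J))%E].
Proof.
case: J => lo hi loc hic le_lohi; rewrite /noninf /= => lohi.
have std_le x : imem (mkInterval loc hic le_lohi) x ->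
    (stdE lo <= (stdp x)%:E <= stdE hi)%E.
  rewrite /imem /= => -[xlo xhi]; apply/andP; split.
    have : leE lo (Fin x) by case: loc xlo => // -[].
    by case: lo {xlo le_lohi lohi} => //= [_|a /leFR_stdp]; rewrite ?lee_fin ?leNye.
  have : leE (Fin x) hi by case: hic xhi => // -[].
  by case: hi {xhi le_lohi lohi} => //= [a /leFR_stdp|_]; rewrite ?lee_fin ?leey.
have std_lt x : (stdE lo < (stdp x)%:E < stdE hi)%E -> imem (mkInterval loc hic le_lohi) x.
  rewrite /imem /= => /andP[lox xhi].
  have lo_lt : ltE lo (Fin x).
    case: lo lox {le_lohi lohi std_le} => //= a; rewrite lte_fin => ax; split.
      exact: stdp_lt_leFR.
    by move=> [E]; rewrite E ltxx in ax.
  have hi_lt : ltE (Fin x) hi.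
    case: hi xhi {le_lohi lohi std_le} => //= a; rewrite lte_fin => ax; split.
      exact: stdp_lt_leFR.
    by move=> [E]; rewrite E ltxx in ax.
  by split; [case: loc {std_le} => //; case: lo_lt|case: hic {std_le} => //; case: hi_lt].
have small (u : R) (b : \bar R) : (u%:E < b)%E -> forall e, 0 < e ->
    exists2 eta : R, 0 < eta & eta <= e /\ forall h, h < u + eta -> (h%:E < b)%E.
  case: b => [b| |]//; last by move=> _ e e0; exists e => //; split => // h _; exact: ltry.
  rewrite lte_fin => ub e e0; exists (Num.min e (b - u)).
    by rewrite lt_min e0 subr_gt0.
  split; first by rewrite ge_min lexx.
  by move=> h hu; rewrite lte_fin; apply: (lt_le_trans hu); rewrite -lerBrDl ge_min lexx orbT.
have small' (u : R) (b : \bar R) : (b < u%:E)%E -> forall e, 0 < e ->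
    exists2 eta : R, 0 < eta & eta <= e /\ forall h, u - eta < h -> (b < h%:E)%E.
  case: b => [b| |]//; last by move=> _ e e0; exists e => //; split => // h _; exact: ltNyr.
  rewrite lte_fin => bu e e0; exists (Num.min e (u - b)).
    by rewrite lt_min e0 subr_gt0.
  split; first by rewrite ge_min lexx.
  by move=> h hu; rewrite lte_fin; apply: le_lt_trans hu; rewrite lerBrDl -lerBrDr ge_min lexx orbT.
split => /=.
- by move=> r Sr; apply: std_lt; rewrite stdp_cstFR.
- move=> r /andP[/small'/(_ 1 ltr01)[e1 e10 [_ H1]] /small/(_ 1 ltr01)[e2 e20 [_ H2]]].
  exists (Num.min e1 e2); first by rewrite lt_min e10.
  move=> h; rewrite lt_min !ltr_norml => /andP[/andP[h1 _] /andP[_ h2]].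
  by rewrite H1 ?H2//; lra.
- move=> y y' r /std_le/andP[loy _] /std_le/andP[_ y'hi] /andP[yr ry'].
  by rewrite (le_lt_trans loy)?lte_fin//= (lt_le_trans _ y'hi)// lte_fin.
- move=> y e /std_le/andP[loy yhi] e0.
  (* Approach from the right when there is room; over the right end, [noninf] leaves room on the
     left. *)
  have [yhi'|hiy] := ltP (stdp y)%:E (stdE hi).
    have [eta eta0 [etae H]] := small _ _ yhi' e e0.
    exists (stdp y + eta / 2); last by rewrite addrC addKr gtr0_norm ?divr_gt0//; lra.
    rewrite H ?andbT; last by lra.
    by rewrite (le_lt_trans loy)// lte_fin; lra.
  have loy' : (stdE lo < (stdp y)%:E)%E by exact: lt_le_trans lohi hiy.
  have [eta eta0 [etae H]] := small' _ _ loy' e e0.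
  exists (stdp y - eta / 2); last by rewrite addrC addKr normrN gtr0_norm ?divr_gt0//; lra.
  rewrite H /=; last by lra.
  by apply: lt_le_trans yhi; rewrite lte_fin; lra.
Qed.

Lemma primitive_unique J f u1 u2 F1 F2 : noninf J ->
  is_primitive (imem J) f u1 F1 -> is_primitive (imem J) f u2 F2 ->
  forall v w, imem J v -> imem J w -> F1 v - F2 v = F1 w - F2 w.
Proof.
move=> nJ [_ _ d1] [_ _ d2] v w Jv Jw; apply/FR_eqP.
have De x : imem J x ->
    has_expansion (imem J) (fun y t => rep (F1 y) t - rep (F2 y) t) (fun=> 0) x.
  by move=> Jx; apply: has_expansionB; apply: FRderiv_expansion; eauto.
have := expansion0_constant (noninf_interval_core nJ) De Jv Jw.
move=> /little_oD/(_ (little_oB (rep_subFR (F1 v) (F2 v)) (rep_subFR (F1 w) (F2 w)))).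
by apply: little_o_eq => t; ring.
Qed.

Lemma FRint_increment J f : noninf J -> exists F : FR R -> FR R,
  forall a b, imem J a -> imem J b -> FRint (imem J) f a b = F b - F a.
Proof.
move=> nJ.
have [[u [F Fp]]|nF] := pselect (exists u F, is_primitive (imem J) f u F).
  exists F => a b Ja Jb; rewrite /FRint; case: pselect => [h|]; last first.
    by case; exists (fun y => F y - F a); exact: is_primitive_translate Fp.
  have Ip : is_primitive (imem J) f a (sval (cid h)) := svalP (cid h).
  have := primitive_unique nJ Ip Fp Jb Ja.
  have [_ -> _] := Ip.
  by move=> /(canRL (subrK _)) ->; rewrite [RHS]addrC; congr (_ + _); exact: add0r.
(* A constant [F] reproduces the default value. *)
exists (fun=> 0) => a b _ _; rewrite subr0 /FRint; case: pselect => // -[F Fp].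
by exfalso; apply: nF; exists a, F.
Qed.

Lemma imem_itv I a b x : ilo I = Fin a -> ihi I = Fin b ->
  ((a < x < b)%O -> imem I x) /\ (imem I x -> (a <= x <= b)%O).
Proof.
rewrite /imem /= => -> ->; split.
  move=> /andP[/ltFRE[ax axn] /ltFRE[xb xbn]].
  by split; case: ifP => // _; split => // -[E].
move=> [xa xb]; apply/andP; split; apply/leFRE.
  by move: xa; case: ifP => // _ [].
by move: xb; case: ifP => // _ [].
Qed.

End Integral.

Theorem theorem34 (R : realType) (J : FRinterval R) (f : FR R -> FR R)
    (n m : nat) (I_ : 'I_n -> FRinterval R) (J_ : 'I_m -> FRinterval R) :
  noninf J ->
  smoothFR (imem J) f ->
  (forall i, imem (I_ i) `<=` imem J) ->
  (forall j, imem (J_ j) `<=` imem J) ->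
  (forall i, endpoints_in (imem J) (I_ i)) ->
  (forall j, endpoints_in (imem J) (J_ j)) ->
  (forall i i', i != i' -> imem (I_ i) `&` imem (I_ i') = set0) ->
  (forall j j', j != j' -> imem (J_ j) `&` imem (J_ j') = set0) ->
  \bigcup_(i in [set: 'I_n]) imem (I_ i) = \bigcup_(j in [set: 'I_m]) imem (J_ j) ->
  \big[@addFR R/fr0 R]_(i < n) FRintI (imem J) f (I_ i) =
  \big[@addFR R/fr0 R]_(j < m) FRintI (imem J) f (J_ j).
Proof.
move=> nJ _ _ _ endI endJ disjI disjJ UIJ.
have [F HF] := FRint_increment f nJ.
have ends k (K : 'I_k -> FRinterval R) : (forall i, endpoints_in (imem J) (K i)) ->
    exists a b : 'I_k -> FR R, forall i, [/\ ilo (K i) = Fin (a i), ihi (K i) = Fin (b i),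
      (a i <= b i)%O & FRintI (imem J) f (K i) = F (b i) - F (a i)].
  move=> /choice[a /choice[b Hab]]; exists a, b => i.
  have [lo hi Ja Jb] := Hab i; split => //.
    by apply/leFRE; have := i_le (K i); rewrite lo hi.
  by rewrite /FRintI lo hi HF.
have [a [b Hab]] := ends _ _ endI; have [a' [b' Hab']] := ends _ _ endJ.
pose l := codom a ++ codom b ++ codom a' ++ codom b'.
pose s := sort <=%O (undup l).
have ss : sorted <%O s by rewrite sort_lt_sorted undup_uniq.
have mem_s x : x \in l -> x \in s by rewrite mem_sort mem_undup.
have midP (x y : FR R) : (x < y)%O -> (x < midFR x y < y)%O.
  by move=> /midFR_lt.
(* The right-hand side sees the family only through its union, so [UIJ] identifies the two sums. *)
have key k (K : 'I_k -> FRinterval R) (u v : 'I_k -> FR R) :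
    (forall i, u i \in s) -> (forall i, v i \in s) ->
    (forall i, [/\ ilo (K i) = Fin (u i), ihi (K i) = Fin (v i),
      (u i <= v i)%O & FRintI (imem J) f (K i) = F (v i) - F (u i)]) ->
    (forall i i', i != i' -> imem (K i) `&` imem (K i') = set0) ->
    \big[@addFR R/fr0 R]_(i < k) FRintI (imem J) f (K i) =
    \sum_(q < (size s).-1)
      if `[< (\bigcup_(i in [set: 'I_k]) imem (K i)) (midFR (nth 0 s q) (nth 0 s q.+1)) >]
      then F (nth 0 s q.+1) - F (nth 0 s q) else 0.
  move=> us vs Huv Kdisj.
  rewrite (eq_bigr (fun i => F (v i) - F (u i))) => [|i _]; last by have [] := Huv i.
  apply: (sum_disjoint_increments F 0 midP ss us vs _ _ _ Kdisj) => i; have [lo hi ? _] := Huv i => //.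
    by move=> x; exact: (imem_itv x lo hi).1.
  by move=> x; exact: (imem_itv x lo hi).2.
rewrite (key _ _ a b) ?(key _ _ a' b') ?UIJ//.
- by move=> i; apply/mem_s; rewrite /l !mem_cat codom_f ?orbT.
- by move=> i; apply/mem_s; rewrite /l !mem_cat codom_f ?orbT.
- by move=> i; apply/mem_s; rewrite /l !mem_cat codom_f ?orbT.
- by move=> i; apply/mem_s; rewrite /l !mem_cat codom_f ?orbT.
Qed.
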